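(* Let $(A,\Sigma)$ be an Artin-Tits system of spherical type, let $X\subseteq\Sigma$, $\alpha\in A$, and let $P=\alpha A_X\alpha^{-1}$ be the corresponding parabolic subgroup of $A$, with central Garside element $c_P=\alpha c_X\alpha^{-1}$. If $c_P=ab^{-1}$ is in $pn$-normal form, then $b$ is the minimal standardizer of $P$; that is, $b$ is a positive element such that $b^{-1}Pb$ is a standard parabolic subgroup, and $b\preccurlyeq g$ for every positive element $g\in A$ such that $g^{-1}Pg$ is a standard parabolic subgroup.
   Context: An Artin-Tits group $A$ has a finite generating set $\Sigma=\{\sigma_i: i\in S\}$ and relations $\sigma_i\sigma_j\sigma_i\cdots=\sigma_j\sigma_i\sigma_j\cdots$ ($m_{i,j}$ letters on each side) for $i\ne j$ with $m_{i,j}\neq\infty$, where $(m_{i,j})$ is a symmetric matrix with $m_{i,i}=1$ and $m_{i,j}\in\{2,\dots,\infty\}$ for $i\neq j$. It is of spherical type if the Coxeter group obtained by adding the relations $\sigma_i^2=1$ is finite. An element is positive if it lies in the submonoid $\mathcal P=A^+$ generated by $\Sigma$. The prefix order is $a\preccurlyeq b\iff a^{-1}b\in\mathcal P$; the suffix order is $a\succcurlyeq b\iff ab^{-1}\in\mathcal P$ (then $b$ is a suffix of $a$). Both are lattice orders on $A$. For $X\subseteq\Sigma$, $A_X$ denotes the subgroup generated by $X$ (a standard parabolic subgroup); it is an Artin-Tits group of spherical type with generating set $X$. A parabolic subgroup is a conjugate of a standard one. $\Delta_X$ denotes the Garside element of $A_X$, i.e. the least common multiple of $X$ with respect to $\preccurlyeq$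 (equivalently $\succcurlyeq$). The central Garside element of $A_X$ is $c_X=(\Delta_X)^e$, where $e$ is the minimal positive integer such that $(\Delta_X)^e$ lies in the center $Z(A_X)$. For $P=\alpha A_X\alpha^{-1}$ one sets $c_P=\alpha c_X\alpha^{-1}$. A decomposition $x=ab^{-1}$ is in $pn$-normal form if $a,b\in\mathcal P$ and the greatest common divisor of $a$ and $b$ with respect to $\succcurlyeq$ is $1$ (that is, $a,b$ have no nontrivial common positive suffix). *)

(* Defs.v *)
From mathcomp Require Import all_boot fingroup.
From mathcomp Require Import mathcomp_extra boolp classical_sets.

Set Implicit Arguments.
Unset Strict Implicit.
Unset Printing Implicit Defensive.

Local Open Scope classical_set_scope.
Local Open Scope group_scope.

(* A letter (i, e) stands for the generator i if e = false, and for its formal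
   inverse if e = true. *)
Definition word (S : Type) : Type := seq (S * bool).

Inductive word_equiv (S : Type) (R : word S -> word S -> Prop) :
    word S -> word S -> Prop :=
| word_equiv_rel u v : R u v -> word_equiv R u v
| word_equiv_inv i e : word_equiv R [:: (i, e); (i, ~~ e)] [::]
| word_equiv_refl u : word_equiv R u u
| word_equiv_sym u v : word_equiv R u v -> word_equiv R v u
| word_equiv_trans u v w :
    word_equiv R u v -> word_equiv R v w -> word_equiv R u w
| word_equiv_cat u u' v v' :
    word_equiv R u u' -> word_equiv R v v' -> word_equiv R (u ++ v) (u' ++ v').

Definition eval_word (S : Type) (G : groupType) (sigma : S -> G)
    (w : word S) : G :=
  \prod_(l <- w) (if l.2 then (sigma l.1)^-1 else sigma l.1).

(* G, with generators sigma, is the group presented by the relations R. *)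
Definition is_presented_by (S : Type) (R : word S -> word S -> Prop)
    (G : groupType) (sigma : S -> G) : Prop :=
  (forall g : G, exists w, eval_word sigma w = g) /\
  (forall u v, eval_word sigma u = eval_word sigma v <-> word_equiv R u v).

(* None encodes the value infinity. *)
Definition is_coxeter_matrix (S : Type) (m : S -> S -> option nat) : Prop :=
  [/\ forall i j, m i j = m j i,
      forall i, m i i = Some 1%N
    & forall i j n, i <> j -> m i j = Some n -> (2 <= n)%N].

(* The word i j i j ... with n letters. *)
Definition alternating_word (S : Type) (i j : S) (n : nat) : word S :=
  mkseq (fun k => (if odd k then j else i, false)) n.

Definition artin_rel (S : Type) (m : S -> S -> option nat) (u v : word S) :
    Prop :=
  exists i j n, [/\ i <> j, m i j = Some n,
    u = alternating_word i j n & v = alternating_word j i n].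

Definition coxeter_rel (S : Type) (m : S -> S -> option nat) (u v : word S) :
    Prop :=
  artin_rel m u v \/ exists i, u = [:: (i, false); (i, false)] /\ v = [::].

Definition is_artin_tits_system (S : finType) (m : S -> S -> option nat)
    (A : groupType) (sigma : S -> A) : Prop :=
  is_coxeter_matrix m /\ is_presented_by (artin_rel m) sigma.

Definition is_spherical (S : finType) (m : S -> S -> option nat) : Prop :=
  exists (W : finGroupType) (s : S -> W), is_presented_by (coxeter_rel m) s.

Definition is_submonoid (G : groupType) (M : set G) : Prop :=
  M 1 /\ forall x y, M x -> M y -> M (x * y).

Definition is_subgroup (G : groupType) (H : set G) : Prop :=
  is_submonoid H /\ forall x, H x -> H x^-1.

Definition center (G : groupType) (H : set G) : set G :=
  [set z | H z /\ forall h, H h -> commute z h].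

Section ArtinTits.
Variables (S : finType) (A : groupType) (sigma : S -> A).

Definition positive : set A := smallest (@is_submonoid A) (range sigma).

Definition prefix_le (a b : A) : Prop := positive (a^-1 * b).

(* a ≽ b : b is a suffix of a. *)
Definition suffix_ge (a b : A) : Prop := positive (a * b^-1).

(* A subset of the generating set is given by its set X of indices. *)
Definition standard_parabolic (X : {set S}) : set A :=
  smallest (@is_subgroup A) (sigma @` [set` X]).

Definition is_standard_parabolic (H : set A) : Prop :=
  exists Y : {set S}, H = standard_parabolic Y.

Definition parabolic (alpha : A) (X : {set S}) : set A :=
  [set alpha * x * alpha^-1 | x in standard_parabolic X].

(* Common multiples are taken among positive elements. This matters only for
   E = set0, whose least common multiple is 1; an upper bound of a positive
   element is positive anyway. *)
Definition is_prefix_lcm (E : set A) (d : A) : Prop :=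
  [/\ positive d,
      forall x, E x -> prefix_le x d
    & forall d', positive d' -> (forall x, E x -> prefix_le x d') ->
        prefix_le d d'].

Definition is_suffix_gcd (a b d : A) : Prop :=
  [/\ suffix_ge a d, suffix_ge b d
    & forall d', suffix_ge a d' -> suffix_ge b d' -> suffix_ge d d'].

Definition is_garside (X : {set S}) (D : A) : Prop :=
  is_prefix_lcm (sigma @` [set` X]) D.

Definition is_central_garside (X : {set S}) (c : A) : Prop :=
  exists (D : A) (e : nat),
    [/\ is_garside X D,
        (0 < e)%N /\ center (standard_parabolic X) (D ^+ e),
        forall k, (0 < k)%N -> center (standard_parabolic X) (D ^+ k) ->
          (e <= k)%N
      & c = D ^+ e].

Definition is_pn_normal_form (x a b : A) : Prop :=
  [/\ x = a * b^-1, positive a, positive b & is_suffix_gcd a b 1].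

Definition is_standardizer (P : set A) (g : A) : Prop :=
  positive g /\ is_standard_parabolic [set g^-1 * p * g | p in P].

Definition is_minimal_standardizer (P : set A) (b : A) : Prop :=
  is_standardizer P b /\ forall g, is_standardizer P g -> prefix_le b g.

End ArtinTits.

(* Main.v *)
(* Write [c_X = Delta_X ^ e]. By right invariance of the suffix order, [b] is a
   prefix of every positive [g] such that [c_P g] is positive, so two facts
   suffice.
   (1) If [h A_X h^-1 = A_Y] then [h c_X h^-1] is positive. One may take [h]
   positive. Removing from [h] a prefix in [Y] does not change [h c_X h^-1],
   which is central in [A_Y]; and once [h] has no prefix in [Y], conjugation by
   [h] maps every generator in [X] to a generator in [Y].
   (2) Among the positive [beta] with [c_P = beta Delta_Y ^ e beta^-1] and
   [P = beta A_Y beta^-1] for some [Y], one of minimal length has no suffix in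
   common with [beta Delta_Y ^ e], whence [beta = b]: a common suffix [s] in [Y]
   could be removed from [beta], and a common suffix [s] outside [Y] forces
   [beta] to end with [Delta_(Y + s) Delta_Y^-1], which could also be removed.
   The lattice properties of the positive monoid come from the weak order of the
   finite Coxeter group [W]: the greatest prefix in [W] of a positive word is
   invariant under braid relations. This gives lcms and cancellation, and then,
   a power of [Delta] being central, the embedding of the monoid in [A]. *)
Require Import Defs.
From mathcomp Require Import all_boot fingroup.
From mathcomp Require Import mathcomp_extra boolp classical_sets.
From Stdlib Require Import Morphisms.
From mathcomp Require Import ssralg poly ssrnum algC cyclotomic.
From mathcomp Require Import ring zify.

Set Implicit Arguments.
Unset Strict Implicit.
Unset Printing Implicit Defensive.

Import GRing.Theory Num.Theory.

(** * Alternating words, and words acting through involutions *)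

Fixpoint alt (S : Type) (i j : S) (n : nat) : seq S :=
  if n is n'.+1 then i :: alt j i n' else [::].

Definition pos (S : Type) (u : seq S) : word S := [seq (i, false) | i <- u].

Lemma size_alt (S : Type) (i j : S) n : size (alt i j n) = n.
Proof. by elim: n i j => //= n IH i j; rewrite IH. Qed.

Lemma alternating_wordE (S : Type) (i j : S) n :
  alternating_word i j n = pos (alt i j n).
Proof.
rewrite /alternating_word; elim: n i j => //= n IH i j.
rewrite /pos /= -/(pos _) -IH /mkseq /= (iotaDl 1 0) -map_comp.
by congr cons; apply: eq_map => k /=; case: (odd k).
Qed.

(** The sign of a letter is ignored: the maps [f i] are meant to be involutions, so a generator and
    its formal inverse act alike. *)
Definition wact (S T : Type) (f : S -> T -> T) (x : T) (u : word S) : T :=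
  foldl (fun x l => f l.1 x) x u.

Lemma wact_pos (S T : Type) (f : S -> T -> T) x u :
  wact f x (pos u) = foldl (fun x i => f i x) x u.
Proof. by elim: u x => //= i u IH x; rewrite -IH. Qed.

(** Universal property of the Coxeter presentation. It serves twice: for the contragredient
    representation and for the parity of inversions. *)
Lemma wact_coxeter_rel (S : finType) (T : Type) (m : S -> S -> option nat)
    (f : S -> T -> T) :
    (forall i, involutive (f i)) ->
    (forall i j n x, i <> j -> m i j = Some n ->
       foldl (fun x i => f i x) x (alt i j n) =
       foldl (fun x i => f i x) x (alt j i n)) ->
  forall u v, word_equiv (coxeter_rel m) u v -> forall x, wact f x u = wact f x v.
Proof.
move=> fK fR u v; elim=> {u v} //.
- move=> u v [[i [j [n [ij mij -> ->]]]]|[i [-> ->]]] x.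
    by rewrite !alternating_wordE !wact_pos; apply: fR.
  by rewrite /wact /= fK.
- by move=> i e x; rewrite /wact /= fK.
- by move=> u v w _ IH1 _ IH2 x; rewrite IH1.
- move=> u u' v v' _ IH1 _ IH2 x; rewrite /wact !foldl_cat -/(wact _ _ _).
  by rewrite -!/(wact _ _ _) IH1 IH2.
Qed.

Definition pev (S : Type) (G : groupType) (t : S -> G) (u : seq S) : G :=
  (\prod_(i <- u) t i)%g.

Section PevTheory.
Variables (S : Type) (G : groupType) (t : S -> G).
Local Open Scope group_scope.

Lemma pev_nil : pev t [::] = 1. Proof. by rewrite /pev big_nil. Qed.
Lemma pev_cons i u : pev t (i :: u) = t i * pev t u.
Proof. by rewrite /pev big_cons. Qed.
Lemma pev1 i : pev t [:: i] = t i. Proof. by rewrite pev_cons pev_nil mulg1. Qed.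
Lemma pev_cat u v : pev t (u ++ v) = pev t u * pev t v.
Proof. by rewrite /pev big_cat. Qed.
Lemma pev_rcons u i : pev t (rcons u i) = pev t u * t i.
Proof. by rewrite -cats1 pev_cat pev1. Qed.
Definition pevE := (pev_nil, pev_cons, pev_cat, pev_rcons).
Lemma eval_word_pos u : eval_word t (pos u) = pev t u.
Proof. by rewrite /eval_word /pos big_map. Qed.
Lemma conjg_id (x : G) : x ^ x = x. Proof. by rewrite conjgE mulKg. Qed.
End PevTheory.

(** * Orders of products of two generators *)

Section OrderOfProducts.
Variables (S : finType) (m : S -> S -> option nat).
Hypothesis hm : is_coxeter_matrix m.
Local Open Scope ring_scope.

Let unity_root (n : nat) : algC := xget 1 [set z | n.-primitive_root z]%classic.

Let unity_rootP n : (0 < n)%N -> n.-primitive_root (unity_root n).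
Proof.
move=> /C_prim_root_exists[z hz].
exact: (@xgetPex _ 1 [set z | n.-primitive_root z]%classic (ex_intro _ z hz)).
Qed.

(** Any primitive root of order [2 n] will do, since only its order matters. The value 1 at an
    infinite entry is the convention [cos (pi / infinity) = 1]. *)
Definition rootc (i j : S) : algC :=
  if m i j is Some n then unity_root n.*2 else 1.

(* Twice the Gram matrix of the canonical bilinear form:
   [2 cos (pi / n) = z + 1 / z] for [z] a primitive [2 n]-th root of unity. *)
Definition gram (i j : S) : algC :=
  if i == j then 2 else - (rootc i j + (rootc i j)^-1).

(* The contragredient of the geometric representation. *)
Definition reflect (i : S) (f : S -> algC) : S -> algC :=
  fun k => f k - gram i k * f i.

Definition reflects (f : S -> algC) (u : seq S) :=
  foldl (fun f i => reflect i f) f u.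

Lemma rootcC i j : rootc i j = rootc j i.
Proof. by case: hm => mC _ _; rewrite /rootc mC. Qed.

Lemma rootc_neq0 i j : rootc i j != 0.
Proof.
have [_ _ hm2] := hm; have [_ hm1 _] := hm.
rewrite /rootc; case e: (m i j) => [n|]; last by rewrite oner_eq0.
have [ij|ij] := eqVneq i j.
  move: e; rewrite ij hm1 => -[<-].
  by rewrite (prim_root_eq0 (unity_rootP _)).
have n2 : (0 < n.*2)%N by rewrite double_gt0 (leq_trans _ (hm2 _ _ _ (elimN eqP ij) e)).
by rewrite (prim_root_eq0 (unity_rootP n2)) -lt0n.
Qed.

Lemma reflectK i : involutive (reflect i).
Proof.
by move=> f; apply: funext => k; rewrite /reflect /gram eqxx; ring.
Qed.

(** A reflection at [i], followed by the exchange of [i] and [j], multiplies the linear form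
    [f i + z^-1 * f j] by [z]. Only [z + z^-1] enters, so the inverse root gives a second
    eigenform. *)
Lemma reflects_alt_eigen (i j : S) (z : algC) n f : i != j -> z != 0 ->
  rootc i j + (rootc i j)^-1 = z + z^-1 ->
  let F := reflects f (alt i j n) in
  let i' := if odd n then j else i in let j' := if odd n then i else j in
  F i' + z^-1 * F j' = z ^+ n * (f i + z^-1 * f j).
Proof.
move=> + z0; elim: n i j f => [|n IH] i j f ij ez /=; first by rewrite expr0 mul1r.
have := IH j i (reflect i f); rewrite eq_sym ij rootcC => /(_ isT ez).
rewrite !if_neg /reflects /= => ->.
rewrite /reflect /gram eqxx (negPf ij) ez exprS.
by field.
Qed.

Lemma reflects_alt_span (i j : S) n f :
  exists p q, forall k,
    reflects f (alt i j n) k = f k - gram i k * p - gram j k * q.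
Proof.
elim: n i j f => [|n IH] i j f /=; first by exists 0, 0 => k; rewrite !mulr0 !subr0.
have [p [q e]] := IH j i (reflect i f).
by exists (f i + q), p => k; rewrite e /reflect; ring.
Qed.

Lemma rootc_prim i j n : i != j -> m i j = Some n ->
  [/\ (n.*2).-primitive_root (rootc i j), rootc i j ^+ n = -1
    & (rootc i j) ^+ 2 != 1].
Proof.
have [_ _ hm2] := hm => ij e.
have n2 := hm2 _ _ _ (elimN eqP ij) e.
have n0 : (0 < n.*2)%N by rewrite double_gt0 (leq_trans _ n2).
rewrite /rootc e; move: (unity_root _) (unity_rootP n0) => z pz; split=> //.
  have /eqP := prim_expr_order pz; rewrite -muln2 exprM sqrf_eq1.
  rewrite -(prim_order_dvd pz) => /orP[/(dvdn_leq (ltnW n2))|/eqP//]; lia.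
by rewrite -(prim_order_dvd pz); apply/negP => /(@dvdn_leq _ 2 isT); lia.
Qed.

(** Both eigenforms acquire the factor [z ^ n = -1], which fixes the values at [i] and [j]. The
    other values follow, because [f] moves only along two rows of the Gram matrix. *)
Lemma reflects_alt_braid (i j : S) n f : i <> j -> m i j = Some n ->
  reflects f (alt i j n) = reflects f (alt j i n).
Proof.
move=> /eqP ij e.
have main i' j' : i' != j' -> m i' j' = Some n ->
    let F := reflects f (alt i' j' n) in
    F (if odd n then j' else i') = - f i' /\ F (if odd n then i' else j') = - f j'.
  move=> ij' e' F; have [_ zn z2] := rootc_prim ij' e'.
  have z0 := rootc_neq0 i' j'.
  have := reflects_alt_eigen n f ij' z0 erefl.
  have := reflects_alt_eigen n f ij' (_ : (rootc i' j')^-1 != 0).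
  rewrite invr_eq0 z0 invrK addrC exprVn zn invrN invr1 => /(_ isT erefl) /=.
  rewrite -/F; set z := rootc i' j' in z0 z2 *.
  set x := F _; set y := F _ => e1 e2.
  suff ey : y = - f j'.
    by split=> //; move: e1; rewrite ey => e1; apply: (addIr (z * (- f j'))); rewrite e1; ring.
  have h : (z ^+ 2 - 1) * (y + f j') = 0.
    have -> : (z ^+ 2 - 1) * (y + f j') = z * ((x + z * y) - (x + z^-1 * y)
       + (f i' + z * f j') - (f i' + z^-1 * f j')) by field.
    by rewrite e1 e2; ring.
  move/eqP: h; rewrite mulf_eq0 subr_eq0 (negPf z2) /= addr_eq0 => /eqP //.
have [mC _ _] := hm.
have [p [q epq]] := reflects_alt_span i j n f.
have [p' [q' epq']] := reflects_alt_span j i n f.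
have [A1 A2] := main i j ij e.
have ji : j != i by rewrite eq_sym.
have [B1 B2] := main j i ji (etrans (mC j i) e).
have hij : reflects f (alt i j n) i = reflects f (alt j i n) i /\
           reflects f (alt i j n) j = reflects f (alt j i n) j.
  by move: A1 A2 B1 B2 => /=; case: (odd n) => -> -> -> ->.
case: hij => ei ej.
have [_ _ z2] := rootc_prim ij e; have z0 := rootc_neq0 i j.
move: ei ej; rewrite !epq !epq' /gram !eqxx (negPf ij) eq_sym (negPf ij).
rewrite [rootc j i]rootcC; set z := rootc i j in z0 z2 *; set a := z + _ => ei ej.
(* Up to sign this is the determinant [4 - a ^ 2] of the Gram block of [i] and [j]; as it is
   nonzero, the coefficients along the two rows are determined. *)
have da : (z - z^-1) ^+ 2 != 0.
  rewrite expf_eq0 /= subr_eq0; apply: contra z2 => /eqP zz.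
  by rewrite expr2 {2}zz mulfV.
pose P := p - q'; pose Q := q - p'.
have e1 : 2 * P - a * Q = 0.
  have -> : 2 * P - a * Q = (f i - 2 * q' - - a * p') - (f i - 2 * p - - a * q).
    by rewrite /P /Q; ring.
  by rewrite ei; ring.
have e2 : 2 * Q - a * P = 0.
  have -> : 2 * Q - a * P = (f j - 2 * p' - - a * q') - (f j - - a * p - 2 * q).
    by rewrite /P /Q; ring.
  by rewrite ej; ring.
have hP : (z - z^-1) ^+ 2 * P = 0.
  have -> : (z - z^-1) ^+ 2 * P = - 2 * (2 * P - a * Q) - a * (2 * Q - a * P) .
    by rewrite /a; field.
  by rewrite e1 e2; ring.
have hQ : (z - z^-1) ^+ 2 * Q = 0.
  have -> : (z - z^-1) ^+ 2 * Q = - 2 * (2 * Q - a * P) - a * (2 * P - a * Q) .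
    by rewrite /a; field.
  by rewrite e1 e2; ring.
move/eqP: hP; rewrite mulf_eq0 (negPf da) /= subr_eq0 => /eqP hP.
move/eqP: hQ; rewrite mulf_eq0 (negPf da) /= subr_eq0 => /eqP hQ.
by apply: funext => k; rewrite epq epq' hP hQ; ring.
Qed.

(** With Gram entry [-2] the sum [f i + f j] is preserved and is added once per letter, so that the
    values grow without bound. *)
Lemma reflects_alt_affine (i j : S) n f : i != j -> m i j = None ->
  let F := reflects f (alt i j n) in
  let i' := if odd n then j else i in let j' := if odd n then i else j in
  F i' = f i + n%:R * (f i + f j) /\ F i' + F j' = f i + f j.
Proof.
have [mC _ _] := hm.
elim: n i j f => [|n IH] i j f ij e /=; first by split; ring.
have := IH j i (reflect i f); rewrite eq_sym ij mC => /(_ isT e).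
rewrite !if_neg /reflects /= => -[-> ->].
have r1 : rootc i j = 1 by rewrite /rootc e.
rewrite /reflect /gram eqxx (negPf ij) r1 invr1; split; last by ring.
by rewrite -natr1; ring.
Qed.

Variables (W : finGroupType) (s : S -> W).
Hypothesis hW : is_presented_by (coxeter_rel m) s.

Lemma pev_alt_double (G : groupType) (t : S -> G) i j k :
  (pev t (alt i j k.*2) = (t i * t j) ^+ k)%g.
Proof.
elim: k => [|k IH]; first by rewrite pev_nil expg0.
by rewrite doubleS /= !pev_cons IH expgS mulgA.
Qed.

Lemma reflects_alt_expg i j k f : ((s i * s j) ^+ k = 1)%g ->
  reflects f (alt i j k.*2) = f.
Proof.
case: hW => _ h e.
have eq1: word_equiv (coxeter_rel m) (pos (alt i j k.*2)) [::].
  by apply/h; rewrite eval_word_pos pev_alt_double e /eval_word big_nil.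
have braid i' j' n x := @reflects_alt_braid i' j' n x.
by have := wact_coxeter_rel reflectK braid eq1 f; rewrite wact_pos.
Qed.

(** For the indicator [f] of [i], an infinite entry would give the value [1 + 2 * #[s i * s j]] at
    [i], where the finite order forces the value 1. *)
Lemma coxeter_finite_entry i j : exists n, m i j = Some n.
Proof.
have [<-|ij] := eqVneq i j; first by exists 1%N; case: hm.
case e: (m i j) => [n|]; first by exists n.
pose f : S -> algC := fun k => (k == i)%:R.
have := reflects_alt_affine #[s i * s j]%g.*2 f ij e.
rewrite (reflects_alt_expg f (expg_order _)) odd_double /= => -[+ _].
rewrite /f eqxx eq_sym (negPf ij) addr0 mulr1.
move=> /(congr1 (fun t => t - 1)); rewrite subrr addrC addKr => /esym/eqP.
by rewrite pnatr_eq0 double_eq0 eqn0Ngt order_gt0.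
Qed.

(** The eigenform of a root [z] of order [2 n], evaluated at the indicator of [i], gives
    [z ^ (2 k) = 1]. *)
Lemma coxeter_order_dvd i j n k : i != j -> m i j = Some n ->
  ((s i * s j) ^+ k = 1)%g -> (n %| k)%N.
Proof.
move=> ij e ek; have [pz _ _] := rootc_prim ij e.
pose f : S -> algC := fun k => (k == i)%:R.
have := reflects_alt_eigen k.*2 f ij (rootc_neq0 i j) erefl.
rewrite (reflects_alt_expg f ek) odd_double /= /f eqxx eq_sym (negPf ij).
rewrite mulr0 addr0 mulr1 => /esym /eqP.
by rewrite -(prim_order_dvd pz) -!muln2 dvdn_pmul2r.
Qed.

End OrderOfProducts.
(** * Braid equivalence of positive words *)

Section BraidEquiv.
Variables (S : finType) (m : S -> S -> option nat).

(** The congruence on words whose quotient is the Artin monoid. *)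
Inductive braid_equiv : seq S -> seq S -> Prop :=
| braid_rel i j n : i <> j -> m i j = Some n ->
    braid_equiv (alt i j n) (alt j i n)
| braid_refl u : braid_equiv u u
| braid_sym u v : braid_equiv u v -> braid_equiv v u
| braid_trans u v w : braid_equiv u v -> braid_equiv v w -> braid_equiv u w
| braid_cat u u' v v' : braid_equiv u u' -> braid_equiv v v' ->
    braid_equiv (u ++ v) (u' ++ v').

#[local] Hint Resolve braid_refl : core.

Lemma braid_pev (G : groupType) (t : S -> G) u v :
  (forall i j n, i <> j -> m i j = Some n ->
     pev t (alt i j n) = pev t (alt j i n)) ->
  braid_equiv u v -> pev t u = pev t v.
Proof.
move=> ht; elim=> {u v} //; first by move=> u v w _ -> _ ->.
by move=> u u' v v' _ e1 _ e2; rewrite !pev_cat e1 e2.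
Qed.

Lemma braid_size u v : braid_equiv u v -> size u = size v.
Proof.
elim=> {u v} //; first by move=> *; rewrite !size_alt.
  by move=> u v w _ -> _ ->.
by move=> u u' v v' _ e1 _ e2; rewrite !size_cat e1 e2.
Qed.

Lemma mem_alt (i j : S) n : alt i j n.+2 =i [:: i; j].
Proof.
elim: n i j => // n IH i j k; rewrite inE IH !inE.
by case: eqP => //= _; rewrite orbC; case: eqP.
Qed.

Lemma braid_mem u v : is_coxeter_matrix m -> braid_equiv u v -> u =i v.
Proof.
move=> [_ _ m2]; elim=> {u v} //.
- move=> i j [|[|n]] ij e; [by have := m2 _ _ _ ij e|by have := m2 _ _ _ ij e|].
  by move=> k; rewrite !mem_alt !inE orbC.
- by move=> u v _ e k; rewrite e.
- by move=> u v w _ e1 _ e2 k; rewrite e1 e2.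
- by move=> u u' v v' _ e1 _ e2 k; rewrite !mem_cat e1 e2.
Qed.

Lemma alt_rcons (i j : S) n :
  alt i j n.+1 = rcons (alt i j n) (if odd n then j else i).
Proof.
elim: n i j => // n IH i j.
by rewrite -[LHS]/(i :: alt j i n.+1) IH /= if_neg.
Qed.

Lemma rev_alt (i j : S) n :
  rev (alt i j n) = if odd n then alt i j n else alt j i n.
Proof.
elim: n i j => // n IH i j.
by rewrite alt_rcons rev_rcons IH -alt_rcons /=; case: (odd n).
Qed.

(** Reversal is an anti-automorphism of the Artin monoid; it turns statements on prefixes into
    statements on suffixes. *)
Lemma braid_rev u v : is_coxeter_matrix m -> braid_equiv u v ->
  braid_equiv (rev u) (rev v).
Proof.
move=> [mC _ _]; elim=> {u v}.
- move=> i j n ij e; rewrite !rev_alt; case: (odd n); first exact: braid_rel.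
  by apply: braid_rel; [move=> ?; apply: ij|rewrite mC].
- by move=> u; apply: braid_refl.
- by move=> u v _; apply: braid_sym.
- by move=> u v w _ h1 _; apply: braid_trans h1.
- by move=> u u' v v' _ h1 _ h2; rewrite !rev_cat; apply: braid_cat.
Qed.

#[export] Instance braid_equiv_equivalence : Equivalence braid_equiv.
Proof.
split; [exact: braid_refl|exact: braid_sym|].
by move=> u v w; apply: braid_trans.
Qed.

#[export] Instance cat_braid_proper :
  Proper (braid_equiv ==> braid_equiv ==> braid_equiv) cat.
Proof. by move=> u u' h v v'; apply: braid_cat. Qed.

#[export] Instance cons_braid_proper i :
  Proper (braid_equiv ==> braid_equiv) (cons i).
Proof.
by move=> u u' h; rewrite -(cat1s i u) -(cat1s i u'); apply: braid_cat; first exact: braid_refl.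
Qed.

End BraidEquiv.
#[export] Hint Resolve braid_refl : core.

(** * Inversion sets and weak order *)

Section CoxeterGroup.
Variables (S : finType) (m : S -> S -> option nat) (W : finGroupType).
Variable s : S -> W.
Hypothesis hm : is_coxeter_matrix m.
Hypothesis hW : is_presented_by (coxeter_rel m) s.
Local Open Scope group_scope.

Notation ev := (pev s).
Notation "u ≡ v" := (braid_equiv m u v) (at level 70).

Lemma gen_sq i : s i * s i = 1.
Proof.
case: hW => _ /(_ [:: (i, false); (i, false)] [::]) [_ h].
have := h (word_equiv_rel (or_intror (ex_intro _ i (conj erefl erefl)))).
by rewrite /eval_word !big_cons !big_nil mulg1.
Qed.

Lemma genV i : (s i)^-1 = s i.
Proof. by apply: (mulgI (s i)); rewrite gen_sq mulgV. Qed.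

Lemma genK i : cancel (mulg (s i)) (mulg (s i)).
Proof. by move=> x; rewrite mulgA gen_sq mul1g. Qed.

Lemma gen_braid i j n : i <> j -> m i j = Some n -> ev (alt i j n) = ev (alt j i n).
Proof.
move=> ij e; case: hW => _ h; rewrite -!eval_word_pos; apply/h/word_equiv_rel.
by left; exists i, j, n; rewrite !alternating_wordE.
Qed.

Lemma ev_surj w : exists u, ev u = w.
Proof.
case: hW => /(_ w) [u <-] _; exists [seq l.1 | l <- u].
by rewrite /eval_word /pev big_map; apply: eq_bigr => -[i []] _ //=; rewrite genV.
Qed.

Lemma ev_rev u : ev (rev u) = (ev u)^-1.
Proof.
elim: u => [|i u IH]; first by rewrite pev_nil invg1.
by rewrite rev_cons !pevE IH invMg genV.
Qed.

Lemma gen_inj : injective s.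
Proof.
move=> i j e; apply/eqP/negPn/negP => ij.
have [n mij] := coxeter_finite_entry hm hW i j.
have [_ _ /(_ _ _ _ (elimN eqP ij) mij)] := hm.
have /= := coxeter_order_dvd hm hW (k := 1) ij mij; rewrite expg1 e gen_sq => /(_ erefl).
by rewrite dvdn1 => /eqP ->.
Qed.

(* Parity of the number of times the reflection [t] occurs among the
   [s_1 .. s_(k-1) s_k s_(k-1) .. s_1], where [u = s_1 .. s_n]. *)
Fixpoint par (u : seq S) (t : W) : bool :=
  if u is i :: u' then (s i == t) (+) par u' (t ^ s i) else false.

Lemma par_cat u v t : par (u ++ v) t = par u t (+) par v (t ^ ev u).
Proof.
elim: u t => [|i u IH] t /=; first by rewrite pev_nil conjg1.
by rewrite IH pev_cons conjgM addbA.
Qed.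

(** The signed action on reflections, extended to all of [W]; its sign component accumulates
    [par]. *)
Let flip (i : S) (p : W * bool) := (p.1 ^ s i, p.2 (+) (s i == p.1)).

Let flipK i : involutive (flip i).
Proof.
move=> [t e]; rewrite /flip /= -conjgM gen_sq conjg1 -addbA; congr pair.
rewrite (_ : (s i == t ^ s i) = (s i == t)) ?addbb ?addbF //.
by rewrite -{1}(conjg_id (s i)) (inj_eq (conjg_inj _)).
Qed.

Let foldl_flip u p : foldl (fun p i => flip i p) p u = (p.1 ^ ev u, p.2 (+) par u p.1).
Proof.
elim: u p => [|i u IH] [t e] /=; first by rewrite pev_nil conjg1 addbF.
by rewrite IH /= pev_cons conjgM addbA.
Qed.

Lemma shift_expg i j k : s i * (s j * s i) ^+ k = (s i * s j) ^+ k * s i.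
Proof.
elim: k => [|k IH]; first by rewrite !expg0 mulg1 mul1g.
by rewrite expgSr mulgA IH -!mulgA [in RHS]expgSr -!mulgA.
Qed.

Lemma par_alt i j n t :
  par (alt i j n) t = \big[addb/false]_(k < n) ((s i * s j) ^+ k * s i == t).
Proof.
elim: n i j t => [|n IH] i j t /=; first by rewrite big_ord0.
rewrite IH big_ord_recl expg0 mul1g; congr addb; apply: eq_bigr => k _.
rewrite -(inj_eq (conjg_inj (s i))) -conjgM gen_sq conjg1; congr (_ == _).
by rewrite lift0 conjgE genV -[_ * s j * s i]mulgA -expgSr shift_expg.
Qed.

Lemma ev_alt_quo i j n : ev (alt i j n) * (ev (alt j i n))^-1 = (s i * s j) ^+ n.
Proof.
elim: n i j => [|n IH] i j /=; first by rewrite pev_nil mulgV expg0.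
rewrite !pev_cons invMg genV mulgA -[s i * _ * _]mulgA IH.
by rewrite shift_expg -mulgA expgSr.
Qed.

Lemma gen_order i j n : i <> j -> m i j = Some n -> (s i * s j) ^+ n = 1.
Proof. by move=> ij e; rewrite -ev_alt_quo (gen_braid ij e) mulgV. Qed.

(** Since [(s i * s j) ^ n = 1], the two words meet the same [n] reflections, in opposite orders. *)
Lemma par_braid i j n t : i <> j -> m i j = Some n ->
  par (alt i j n) t = par (alt j i n) t.
Proof.
move=> ij e; rewrite !par_alt (reindex_inj rev_ord_inj) /=.
apply: eq_bigr => k _; congr (_ == _).
apply: (mulIg (s j * (s i * s j) ^+ k)).
have -> p : (s i * s j) ^+ p * s i * (s j * (s i * s j) ^+ k) = (s i * s j) ^+ (p + k.+1).
  by rewrite expgD expgS !mulgA.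
have -> : (s j * s i) ^+ k * s j * (s j * (s i * s j) ^+ k) = 1.
  rewrite -mulgA (mulgA (s j)) gen_sq mul1g.
  have -> : s j * s i = (s i * s j)^-1 by rewrite invMg !genV.
  by rewrite expgVn mulVg.
by rewrite -(gen_order ij e); congr (_ ^+ _); have := ltn_ord k; lia.
Qed.

Lemma par_ev u v t : ev u = ev v -> par u t = par v t.
Proof.
move=> e; case: (hW) => _ h.
have uv : word_equiv (coxeter_rel m) (pos u) (pos v).
  by apply/h; rewrite !eval_word_pos.
have braid i j n p : i <> j -> m i j = Some n ->
    foldl (fun p i => flip i p) p (alt i j n) =
    foldl (fun p i => flip i p) p (alt j i n).
  by move=> ij mij; rewrite !foldl_flip (gen_braid ij mij) (par_braid _ ij mij).
have := wact_coxeter_rel flipK braid uv (t, false).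
by rewrite !wact_pos !foldl_flip /= => -[].
Qed.

(** By [par_ev] the choice of the word is immaterial; [locked] prevents it from being unfolded. *)
Definition invset (w : W) : {set W} :=
  locked [set t | par (xget [::] [set u | ev u = w]%classic) t].

Notation N := invset.

Lemma in_invset u t : (t \in N (ev u)) = par u t.
Proof.
rewrite /invset -lock inE; apply: par_ev.
exact: (@xgetPex _ [::] [set v | ev v = ev u]%classic (ex_intro _ u erefl)).
Qed.

Lemma invset1 : N 1 = finset.set0.
Proof. by apply/setP => t; rewrite -(pev_nil s) in_invset inE. Qed.

Lemma invset_mul x y t : (t \in N (x * y)) = (t \in N x) (+) (t ^ x \in N y).
Proof.
have [u <-] := ev_surj x; have [v <-] := ev_surj y.
by rewrite -pev_cat !in_invset par_cat.
Qed.

Lemma invset_gen i : N (s i) = [set s i].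
Proof.
by apply/setP => t; rewrite -pev1 in_invset inE /= addbF pev1 eq_sym.
Qed.

Lemma invsetV w t : (t \in N w^-1) = (t ^ w^-1 \in N w).
Proof.
have := invset_mul w w^-1 (t ^ w^-1); rewrite mulgV invset1 inE -conjgM.
by rewrite mulVg conjg1; case: (t \in _); case: (_ \in _).
Qed.

Definition len (w : W) : nat := #|N w|.

(** * Length and the exchange condition *)

Lemma len1 : len 1 = 0. Proof. by rewrite /len invset1 cards0. Qed.

Lemma len_gen i : len (s i) = 1%N. Proof. by rewrite /len invset_gen cards1. Qed.

Lemma lenV w : len w^-1 = len w.
Proof.
rewrite /len (_ : N w^-1 = N w :^ w) ?cardJg //.
by apply/setP => t; rewrite mem_conjg invsetV.
Qed.

Lemma len_mul_le x y : len (x * y) <= len x + len y.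
Proof.
rewrite /len -[#|N y|](cardJg _ x^-1); apply: leq_trans (leq_card_setU _ _).
apply: subset_leq_card; apply/fintype.subsetP => t; rewrite invset_mul !inE mem_conjgV.
by case: (t \in N x); case: (_ \in N y).
Qed.

Lemma len_mul_disjoint x y :
  (forall t, t \in N x -> t ^ x \notin N y) -> len (x * y) = len x + len y.
Proof.
move=> h; rewrite /len -[#|N y|](cardJg _ x^-1) -cardsUI.
rewrite [X in _ + X](_ : _ = 0) ?addn0; last first.
  apply/eqP; rewrite cards_eq0; apply/eqP/setP => t; rewrite !inE mem_conjgV.
  by apply/negP => /andP[/h /negP].
apply: eq_card => t; rewrite invset_mul !inE mem_conjgV.
by case e: (t \in N x) => //; rewrite (negPf (h _ e)).
Qed.

Lemma len_gen_mul i w : s i \notin N w -> len (s i * w) = (len w).+1.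
Proof.
move=> h; rewrite len_mul_disjoint ?len_gen // => t.
by rewrite invset_gen inE => /eqP ->; rewrite conjg_id.
Qed.

Lemma invset_gen_mul i w : (s i \in N (s i * w)) = (s i \notin N w).
Proof. by rewrite invset_mul invset_gen inE eqxx conjg_id. Qed.

Lemma len_gen_mulN i w : s i \in N w -> len w = (len (s i * w)).+1.
Proof.
by move=> h; have := @len_gen_mul i (s i * w); rewrite genK invset_gen_mul h => ->.
Qed.

Lemma len_ev u : len (ev u) <= size u.
Proof.
elim: u => [|i u IH]; first by rewrite pev_nil len1.
by rewrite pev_cons (leq_trans (len_mul_le _ _)) // len_gen.
Qed.

(** An odd number of occurrences of [t] is at least one; at the first of them, multiplication by [t]
    deletes the letter. *)
Lemma exchange u t : t \in N (ev u) ->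
  exists u1 i u2, u = u1 ++ i :: u2 /\ t * ev u = ev (u1 ++ u2).
Proof.
rewrite in_invset; elim: u t => //= i u IH t; have [<- _|_] := eqVneq (s i) t.
  by exists [::], i, u; rewrite pev_cons genK.
move=> /IH[u1 [j [u2 [-> e]]]]; exists (i :: u1), j, u2; split=> //.
by rewrite /= 2!pev_cons -e conjgE genV !mulgA gen_sq mul1g.
Qed.

Lemma deletion u :
  exists v, [/\ ev v = ev u, size v = len (ev u) & {subset v <= u}].
Proof.
elim: u => [|i u [v [ev_v sz_v sub]]]; first by exists [::]; rewrite pev_nil len1.
rewrite pev_cons -ev_v in sz_v *.
have [h|h] := boolP (s i \in N (ev v)); last first.
  exists (i :: v); rewrite pev_cons len_gen_mul //= sz_v; split=> // j.
  by rewrite !inE => /predU1P[->|/sub ->]; rewrite ?eqxx ?orbT.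
have [v1 [j [v2 [ev12 e]]]] := exchange h.
exists (v1 ++ v2); split=> //.
  apply: succn_inj; rewrite -(len_gen_mulN h) -sz_v ev12 !size_cat /=; lia.
move=> k kv; rewrite inE sub ?orbT // ev12 mem_cat inE.
by move: kv; rewrite mem_cat => /orP[->|->]; rewrite ?orbT.
Qed.

Definition redw (w : W) : seq S :=
  xget [::] [set u | ev u = w /\ size u = len w]%classic.

Lemma redwP w : ev (redw w) = w /\ size (redw w) = len w.
Proof.
have [u eu] := ev_surj w; have [v [e1 e2 _]] := deletion u.
apply: (@xgetPex _ [::] [set u | ev u = w /\ size u = len w]%classic).
by exists v; rewrite -eu.
Qed.

Lemma ev_redw w : ev (redw w) = w. Proof. by case: (redwP w). Qed.
Lemma size_redw w : size (redw w) = len w. Proof. by case: (redwP w). Qed.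

Lemma redw1 : redw 1 = [::].
Proof. by apply: size0nil; rewrite size_redw len1. Qed.

Lemma len_eq0 w : (len w == 0) = (w == 1).
Proof.
apply/eqP/eqP => [|->]; last exact: len1.
by rewrite -size_redw => /size0nil e; rewrite -(ev_redw w) e pev_nil.
Qed.

Lemma invset_redw i u w : redw w = i :: u -> s i \in N w.
Proof.
move=> e; have ew := ev_redw w; have sw := size_redw w.
apply/negPn/negP => /len_gen_mul; rewrite -[in s i * w]ew e pev_cons genK -sw e /=.
by have := len_ev u; lia.
Qed.

Lemma exists_descent w : w != 1 -> exists i, s i \in N w.
Proof.
case e: (redw w) => [|i u] w1; last by exists i; apply: invset_redw e.
by move: w1; rewrite -(ev_redw w) e pev_nil eqxx.
Qed.

(** * Length-additive products and the weak order *)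

Definition radd (x y : W) : bool := len (x * y) == len x + len y.
Definition wle (y w : W) : bool := radd y (y^-1 * w).

(** Both sides say that the length of [x * y * z] is the sum of the three lengths. *)
Lemma radd_assoc x y z : radd x y && radd (x * y) z = radd y z && radd x (y * z).
Proof.
rewrite /radd mulgA.
have := len_mul_le x y; have := len_mul_le y z.
have := len_mul_le (x * y) z; have := len_mul_le x (y * z); rewrite mulgA.
move: (len (x * y * z)) (len (y * z)) (len (x * y)) (len x) (len y) (len z).
by move=> *; lia.
Qed.

Lemma wle_mul x y : wle x (x * y) = radd x y.
Proof. by rewrite /wle mulKg. Qed.

Lemma wleP y w : wle y w -> radd y (y^-1 * w). Proof. by []. Qed.

Lemma wle_trans z y w : wle y z -> wle z w -> wle y w.
Proof.
move=> /wleP yz /wleP zw.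
have := radd_assoc y (y^-1 * z) (z^-1 * w).
by rewrite mulKVg yz zw /= -mulgA mulKVg => /esym/andP[].
Qed.

Lemma wle_refl w : wle w w.
Proof. by rewrite /wle mulVg /radd len1 mulg1 addn0. Qed.

Lemma wle1 w : wle 1 w.
Proof. by rewrite /wle /radd len1 mul1g invg1 mul1g. Qed.

Lemma wle_len y w : wle y w -> len y <= len w.
Proof. by rewrite /wle /radd mulKVg => /eqP ->; apply: leq_addr. Qed.

Lemma wle_eq y w : wle y w -> len w <= len y -> y = w.
Proof.
rewrite /wle /radd mulKVg => /eqP -> h.
have: len (y^-1 * w) == 0 by lia.
by rewrite len_eq0 => /eqP e; rewrite -(mulKVg y w) e mulg1.
Qed.

Lemma wle_anti y w : wle y w -> wle w y -> y = w.
Proof. by move=> h /wle_len; apply: wle_eq. Qed.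

Lemma wle_mul2l x y w : radd x w -> wle y w -> radd x y && wle (x * y) (x * w).
Proof.
move=> xw yw; have := radd_assoc x y (y^-1 * w).
by rewrite mulKVg xw [radd y _]yw /= /wle invMg -mulgA mulKg.
Qed.

Lemma wle_cancel x y w : radd x y -> radd x w -> wle (x * y) (x * w) -> wle y w.
Proof.
have e : (x * y)^-1 * (x * w) = y^-1 * w by rewrite invMg -mulgA mulKg.
rewrite /wle /radd !mulKVg e => /eqP -> /eqP ->.
by rewrite -addnA eqn_add2l.
Qed.

Lemma radd_gen i w : radd (s i) w = (s i \notin N w).
Proof.
rewrite /radd len_gen add1n; case: (boolP (s i \in N w)) => /= h.
  by rewrite (len_gen_mulN h); move: (len _) => n; apply/negbTE; lia.
by rewrite len_gen_mul // eqxx.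
Qed.

Lemma wle_gen i w : wle (s i) w = (s i \in N w).
Proof. by rewrite /wle radd_gen genV invset_gen_mul negbK. Qed.

Lemma radd_gen_descent i w : s i \in N w -> radd (s i) (s i * w).
Proof. by move=> h; rewrite radd_gen invset_gen_mul h. Qed.

Lemma wle_descent i y w : s i \in N y -> s i \in N w ->
  wle y w = wle (s i * y) (s i * w).
Proof.
move=> /radd_gen_descent hy /radd_gen_descent hw; apply/idP/idP.
  by rewrite -{1}(genK i y) -{1}(genK i w); apply: wle_cancel.
by move=> /(wle_mul2l hw) /andP[_]; rewrite !genK.
Qed.

Lemma descent_wle i y w : wle y w -> s i \in N y -> s i \in N w.
Proof. by move=> h; rewrite -!wle_gen => /wle_trans; apply. Qed.

(** * Reflections *)

Definition is_refl (t : W) : Prop := exists g i, t = s i ^ g.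

Lemma is_refl_conj t g : is_refl t -> is_refl (t ^ g).
Proof. by move=> [h [i ->]]; exists (h * g), i; rewrite conjgM. Qed.

Lemma is_refl_invset w t : t \in N w -> is_refl t.
Proof.
rewrite -{1}(ev_redw w) in_invset; elim: (redw w) t => //= i u IH t.
have [<- _|_ /IH] := eqVneq (s i) t; first by exists 1, i; rewrite conjg1.
by move=> /(is_refl_conj (s i)); rewrite -conjgM gen_sq conjg1.
Qed.

Lemma invset_refl t : is_refl t -> t \in N t.
Proof.
move=> [g [i ->]]; rewrite {2}conjgE invset_mul invsetV conjgK invset_gen_mul.
by case: (_ \in _).
Qed.

Lemma len_refl_mul w t : t \in N w -> len (t * w) < len w.
Proof.
rewrite -{1}(ev_redw w) => /exchange[u1 [i [u2 [e1 e2]]]].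
rewrite -(size_redw w) e1 -{1}(ev_redw w) e2 (leq_ltn_trans (len_ev _)) //.
by rewrite !size_cat /=; lia.
Qed.

Lemma len_refl_mulN w t : is_refl t -> t \notin N w -> len w < len (t * w).
Proof.
move=> ht tw; have /len_refl_mul : t \in N (t * w).
  by rewrite invset_mul invset_refl // conjg_id (negPf tw).
have tt : t * t = 1.
  by have [g [i ->]] := ht; rewrite -conjMg gen_sq conj1g.
by rewrite mulgA tt mul1g.
Qed.

(** * Standard parabolic subgroups of the Coxeter group and their longest elements *)

Definition WX (X : {set S}) : {group W} := <<s @: X>>%G.
Definition wX (X : {set S}) : W := [arg max_(w > 1 in WX X) len w].

Lemma gen_in_WX (X : {set S}) i : i \in X -> s i \in WX X.
Proof. by move=> iX; apply/mem_gen/imset_f. Qed.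

Lemma ev_in_WX (X : {set S}) u : {subset u <= X} -> ev u \in WX X.
Proof.
elim: u => [|i u IH] h; first by rewrite pev_nil group1.
rewrite pev_cons groupM ?gen_in_WX ?IH ?h ?mem_head // => j ju.
by rewrite h // inE ju orbT.
Qed.

Lemma WX_word (X : {set S}) w : w \in WX X -> exists2 u, {subset u <= X} & ev u = w.
Proof.
move=> /gen_prodgP[n [c hc ->]].
have hc' k : exists2 i, i \in X & c k = s i by have /imsetP := hc k.
elim: n c {hc} hc' => [|n IH] c hc; first by exists [::]; rewrite ?big_ord0 ?pev_nil.
have [i iX e0] := hc ord0.
have [u uX eu] := IH (fun k => c (lift ord0 k)) (fun k => hc _).
exists (i :: u); last by rewrite pev_cons big_ord_recl e0 eu.
by move=> j; rewrite inE => /predU1P[->|/uX].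
Qed.

Lemma WX_redw (X : {set S}) w : w \in WX X ->
  exists u, [/\ {subset u <= X}, ev u = w & size u = len w].
Proof.
move=> /WX_word[u uX <-]; have [v [e1 e2 vu]] := deletion u.
by exists v; split=> // i /vu /uX.
Qed.

Lemma gen_WX (X : {set S}) i : (s i \in WX X) = (i \in X).
Proof.
apply/idP/idP; last exact: gen_in_WX.
move=> /WX_redw[u [uX e]]; rewrite len_gen.
case: u uX e => [|j [|]] // uX; rewrite pev1 => /gen_inj <- _.
by apply: uX; rewrite mem_head.
Qed.

Lemma invset_WX (X : {set S}) w t : w \in WX X -> t \in N w -> t \in WX X.
Proof.
move=> /WX_word[u uX <-] /exchange[u1 [i [u2 [eu e]]]].
have -> : t = ev (u1 ++ u2) * (ev u)^-1 by rewrite -e mulgK.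
rewrite groupM ?groupV ?ev_in_WX // => j; rewrite mem_cat => h.
by rewrite uX // eu mem_cat inE orbCA h orbT.
Qed.

Lemma wXP (X : {set S}) : wX X \in WX X /\ forall w, w \in WX X -> len w <= len (wX X).
Proof. by rewrite /wX; case: arg_maxnP => //; apply: group1. Qed.

Lemma wX_in (X : {set S}) : wX X \in WX X. Proof. by case: (wXP X). Qed.

(** A reflection of [WX X] that is not an inversion would lengthen the longest element. *)
Lemma invset_wX (X : {set S}) t : (t \in N (wX X)) <-> is_refl t /\ t \in WX X.
Proof.
split=> [h|[h1 h2]]; first by split; [apply: is_refl_invset h|apply: invset_WX h; apply: wX_in].
apply/negPn/negP => /(len_refl_mulN h1); rewrite ltnNge => /negP; apply.
by case: (wXP X) => h; apply; apply: groupM.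
Qed.

Lemma invset_mul_wX (X : {set S}) w : w \in WX X -> N (w * wX X) = N (wX X) :\: N w.
Proof.
move=> hw; apply/setP => t; rewrite inE invset_mul.
have [tX|tX] := boolP (t \in N (wX X)); last first.
  have h : t \in N w -> t \in N (wX X).
    by move=> ht; apply/invset_wX; split; [apply: is_refl_invset ht|apply: invset_WX ht].
  rewrite (negPf (contra h tX)) /=.
  apply: contraNF tX => /invset_wX[h1 h2]; apply/invset_wX; split.
    by rewrite -(conjgK w t); apply: is_refl_conj.
  by rewrite -(groupJr _ hw).
rewrite andbT (_ : t ^ w \in _) ?addbT //.
have /invset_wX[h1 h2] := tX.
by apply/invset_wX; split; [apply: is_refl_conj|rewrite groupJr].
Qed.

Lemma len_mul_wX (X : {set S}) w : w \in WX X -> len (w * wX X) = len (wX X) - len w.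
Proof.
move=> hw; rewrite /len invset_mul_wX // cardsD (finset.setIidPr _) //.
apply/fintype.subsetP => t ht; apply/invset_wX.
by split; [apply: is_refl_invset ht|apply: invset_WX ht].
Qed.

Lemma wle_wX (X : {set S}) w : w \in WX X -> wle w (wX X).
Proof.
move=> hw; rewrite /wle /radd mulKVg len_mul_wX ?groupV // lenV.
by have [_ /(_ w hw)] := wXP X; lia.
Qed.

(** The inversions of [x * wX X] are the reflections of [WX X] missing from [x]. None of them is a
    generator, so a reduced word over [X] has no first letter. *)
Lemma descents_WX (X : {set S}) x : x \in WX X -> (forall i, i \in X -> s i \in N x) ->
  x * wX X = 1.
Proof.
move=> hx h; apply/eqP; rewrite -len_eq0 -size_redw.
have [u [uX eu su]] := WX_redw (groupM hx (wX_in X)).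
rewrite size_redw -su; case: u uX eu su => //= i u uX eu su.
have iX : i \in X by apply: uX; rewrite mem_head.
have: s i \in N (x * wX X).
  apply/negPn/negP => /len_gen_mul; rewrite -su -eu pev_cons genK.
  by have := len_ev u; lia.
by rewrite invset_mul_wX // inE h.
Qed.

Lemma descent_wX (X : {set S}) i : i \in X -> s i \in N (wX X).
Proof.
by move=> iX; apply/invset_wX; split; [exists 1, i; rewrite conjg1|apply: gen_in_WX].
Qed.

Lemma wX_sq (X : {set S}) : wX X * wX X = 1.
Proof. by apply: descents_WX (wX_in X) _ => i; apply: descent_wX. Qed.

Lemma wXV (X : {set S}) : (wX X)^-1 = wX X.
Proof. by apply: (mulgI (wX X)); rewrite wX_sq mulgV. Qed.

Lemma descents_eq_wX (X : {set S}) x : x \in WX X -> (forall i, i \in X -> s i \in N x) ->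
  x = wX X.
Proof. by move=> hx /(descents_WX hx) e; apply: (mulIg (wX X)); rewrite e wX_sq. Qed.

(** Coset decomposition: when [x] in [WX X] leaves the shortest remainder, that remainder has no
    inversion in [WX X]. All descents in [X] then come from [x], which must be [wX X]. *)
Lemma wle_descents (X : {set S}) w : (forall i, i \in X -> s i \in N w) -> wle (wX X) w.
Proof.
move=> h; pose x := [arg min_(x < 1 in WX X) len (x^-1 * w)].
have [hx xmin] : x \in WX X /\ forall y, y \in WX X -> len (x^-1 * w) <= len (y^-1 * w).
  by rewrite /x; case: arg_minnP => //; apply: group1.
have noT t : t \in WX X -> t \notin N (x^-1 * w).
  move=> tX; apply/negP => /len_refl_mul.
  by rewrite ltnNge mulgA -{1}[t]invgK -invMg xmin // groupM ?groupV.
have xw : x * (x^-1 * w) = w by rewrite mulKVg.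
have -> : wX X = x.
  apply/esym/descents_eq_wX => // i iX; have := h i iX; rewrite -{1}xw invset_mul.
  by rewrite (negPf (noT _ _)) ?addbF // groupJr // gen_in_WX.
rewrite /wle /radd len_mul_disjoint // => t tx.
by rewrite noT // groupJr //; apply: invset_WX tx.
Qed.

Lemma len_alt i j n k : i != j -> m i j = Some n -> k <= n ->
  len (ev (alt i j k)) = k.
Proof.
have [mC _ _] := hm.
elim: k i j => [|k IH] i j ij e kn; first by rewrite pev_nil len1.
have ji : j != i by rewrite eq_sym.
have e' : m j i = Some n by rewrite mC.
rewrite pev_cons len_gen_mul ?IH // 1?ltnW // in_invset par_alt big1 // => l _.
apply/negP => /eqP el; have : (s j * s i) ^+ l.+1 = 1.
  by rewrite expgSr mulgA el gen_sq.
move=> /(coxeter_order_dvd hm hW ji e') /(dvdn_leq (ltn0Sn l)).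
by have := ltn_ord l; lia.
Qed.

Lemma ev_alt_wX i j n : i != j -> m i j = Some n -> ev (alt i j n) = wX [set i; j].
Proof.
move=> ij e; apply: descents_eq_wX.
  apply: ev_in_WX => l; have : {subset alt i j n <= [:: i; j]}; last first.
    by move=> h /h; rewrite !inE.
  move=> {}l; elim: n i j {ij e} => //= n IH i j; rewrite !inE => /predU1P[->|/IH].
    by rewrite eqxx.
  by rewrite !inE orbC.
have [mC _ m2] := hm.
have main i' j' : i' != j' -> m i' j' = Some n -> s i' \in N (ev (alt i' j' n)).
  move=> ij' e'; have /len_alt := ij' => /(_ n n e' (leqnn _)).
  have := m2 _ _ _ (elimN eqP ij') e'.
  case: n {e} e' => //= n e' _ h.
  rewrite pev_cons invset_gen_mul; apply/negP => /len_gen_mulN.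
  rewrite -pev_cons h => e1; have := len_ev (alt j' i' n).
  by rewrite size_alt e1; lia.
move=> l; rewrite !inE => /orP[]/eqP ->; first exact: main.
by rewrite (gen_braid (elimN eqP ij) e); apply: main; rewrite 1?eq_sym 1?mC.
Qed.

(** Induction on the length of [a], removing a common first generator. *)
Lemma exists_meet a b : exists z, [/\ wle z a, wle z b
  & forall y, wle y a -> wle y b -> wle y z].
Proof.
have [n] := ubnP (len a); elim: n a b => // n IH a b an.
have [/existsP[i /andP[ia ib]]|no] := boolP [exists i, (s i \in N a) && (s i \in N b)]; last first.
  exists 1; rewrite !wle1; split=> // y ya yb.
  have [->|y1] := eqVneq y 1; first exact: wle1.
  have [i iy] := exists_descent y1; case/negP: no; apply/existsP; exists i.
  by rewrite !(descent_wle _ iy).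
(* For each common descent [j], induction yields the greatest common prefix among those that start
   with [s j]. *)
have step j : s j \in N a -> s j \in N b -> exists g, [/\ s j \in N g, wle g a, wle g b
    & forall y, s j \in N y -> wle y a -> wle y b -> wle y g].
  move=> ja jb; have /IH : len (s j * a) < n by rewrite -ltnS -(len_gen_mulN ja).
  move=> /(_ (s j * b)) [g [ga gb gm]].
  have /andP[rg ga'] := wle_mul2l (radd_gen_descent ja) ga.
  have /andP[_ gb'] := wle_mul2l (radd_gen_descent jb) gb.
  have hg : s j \in N (s j * g) by rewrite invset_gen_mul -radd_gen.
  exists (s j * g); rewrite !genK in ga' gb' *; split=> // y jy ya yb.
  by rewrite (wle_descent jy hg) genK; apply: gm; rewrite -wle_descent.
have [g [ig ga gb gm]] := step i ia ib.
exists g; split=> // y ya yb.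
have [->|y1] := eqVneq y 1; first exact: wle1.
have [j jy] := exists_descent y1.
have ja := descent_wle ya jy; have jb := descent_wle yb jy.
have [q [jq qa qb qm]] := step j ja jb.
apply: (@wle_trans q); first exact: qm.
apply: gm => //.
(* The bounds for two descents are comparable: [a] and [b] lie above [wX [set i; j]], hence so does
   [q]. Thus [q] has the descent [i] and lies below [g]. *)
have wXle w : s i \in N w -> s j \in N w -> wle (wX [set i; j]) w.
  by move=> iw jw; apply: wle_descents => k; rewrite !inE => /orP[]/eqP ->.
have : wle (wX [set i; j]) q.
  by apply: qm; rewrite ?wXle //; apply: descent_wX; rewrite !inE eqxx orbT.
by move=> /descent_wle; apply; apply: descent_wX; rewrite !inE eqxx.
Qed.

Lemma wX_conj (X : {set S}) i : i \in X -> exists2 j, j \in X & s j * wX X = wX X * s i.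
Proof.
move=> iX; have h : wX X * s i * wX X \in WX X by rewrite !groupM ?wX_in ?gen_in_WX.
have l1 : len (wX X * s i * wX X) = 1%N.
  rewrite len_mul_wX ?groupM ?wX_in ?gen_in_WX //.
  have -> : wX X * s i = (s i * wX X)^-1 by rewrite invMg genV wXV.
  rewrite lenV len_mul_wX ?gen_in_WX // len_gen.
  by have := len_gen_mulN (descent_wX iX); lia.
have [u [uX eu]] := WX_redw h; rewrite l1.
case: u uX eu => [|j [|]] // uX; rewrite pev1 => e _.
exists j; first by apply: uX; rewrite mem_head.
by rewrite e -!mulgA wX_sq mulg1.
Qed.

Let exists_cap (u h : W) : exists y, [/\ wle y h, radd u y
  & forall z, wle z h -> radd u z -> wle z y].
Proof.
have WT w : w \in WX [set: S].
  by rewrite -(ev_redw w); apply: ev_in_WX => i _; rewrite inE.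
(* A product after [u] is reduced exactly for the prefixes of [u^-1] times the longest element, so
   the element sought is a meet. *)
have raddE z : radd u z = wle z (u^-1 * wX [set: S]).
  have uw : radd u (u^-1 * wX [set: S]) by apply: wle_wX (WT u).
  apply/idP/idP => [uz|/(wle_mul2l uw)/andP[] //].
  apply: (wle_cancel uz uw); rewrite mulKVg; exact: wle_wX (WT _).
have [y [h1 h2 h3]] := exists_meet h (u^-1 * wX [set: S]).
by exists y; rewrite raddE; split=> // z; rewrite raddE; apply: h3.
Qed.

(* The greatest prefix [y] of [h] such that the product [u * y] is reduced. *)
Definition cap (u h : W) : W :=
  xget 1 [set y | [/\ wle y h, radd u y
    & forall z, wle z h -> radd u z -> wle z y]]%classic.

Lemma capP u h : [/\ wle (cap u h) h, radd u (cap u h)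
  & forall z, wle z h -> radd u z -> wle z (cap u h)].
Proof.
exact: (@xgetPex _ 1 [set y | [/\ wle y h, radd u y
  & forall z, wle z h -> radd u z -> wle z y]]%classic (exists_cap u h)).
Qed.

Lemma cap_eq u h y : wle y h -> radd u y ->
  (forall z, wle z h -> radd u z -> wle z y) -> cap u h = y.
Proof.
by have [h1 h2 h3] := capP u h => h4 h5 h6; apply: wle_anti; [apply: h6|apply: h3].
Qed.

(** The cocycle rule behind [act_mul]: absorbing [u * v] at once, or first [v] and then [u], takes
    the same part of [h]. *)
Lemma cap_mul u v h : radd u v ->
  cap u (v * cap v h) = v * cap (u * v) h.
Proof.
move=> uv; have [h1 h2 h3] := capP v h; have [k1 k2 k3] := capP (u * v) h.
have rv z : radd (u * v) z -> radd v z && radd u (v * z).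
  by move=> r; rewrite -radd_assoc uv r.
have /andP[r1 r2] := rv _ k2.
have [q1 q2 q3] := capP u (v * cap v h).
have /andP[rv' le1] := wle_mul2l h2 (h3 _ k1 r1).
have le2 : wle (v * cap (u * v) h) (cap u (v * cap v h)) by apply: q3.
have vq : wle v (cap u (v * cap v h)) by apply: wle_trans le2; rewrite wle_mul.
apply: wle_anti => //; move: vq q1 q2; set q := cap u _.
rewrite -(mulKVg v q); move: (v^-1 * q) => z vz q1 q2.
rewrite wle_mul in vz.
have zle := wle_cancel vz h2 q1.
have := radd_assoc u v z; rewrite uv vz q2 => uvz.
by have /andP[] := wle_mul2l r1 (k3 _ (wle_trans zle h1) uvz).
Qed.

(** * Greatest simple prefixes, cancellation and lcms *)

Lemma reduced_cons i u : size (i :: u) = len (ev (i :: u)) ->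
  s i \in N (ev (i :: u)) /\ size u = len (ev u).
Proof.
move=> h; have := len_ev u; have := len_mul_le (s i) (ev u).
rewrite -pev_cons len_gen -h /= add1n ltnS => h1 h2.
have e : size u = len (ev u) by apply/eqP; rewrite eqn_leq h1 h2.
split=> //; rewrite pev_cons invset_gen_mul; apply/negP => /len_gen_mulN.
by rewrite -pev_cons -h -e /=; lia.
Qed.

(** If the first letters [i] and [j] differ, the common value lies above the longest element of
    their dihedral subgroup. By induction on the tails, each word is equivalent to an alternating
    word followed by the same [y], and one braid relation joins the two. *)
Lemma matsumoto u v : size u = len (ev u) -> size v = len (ev v) ->
  ev u = ev v -> u ≡ v.
Proof.
have [n] := ubnP (size u); elim: n u v => // n IH u v un ru rv e.
case: u v un ru rv e => [|i u] [|j v] un ru rv e; [exact: braid_refl| | |].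
- by move: rv; rewrite -e pev_nil len1.
- by move: ru; rewrite e pev_nil len1.
have [iw ru'] := reduced_cons ru; have [jw rv'] := reduced_cons rv.
rewrite /= ltnS in un.
have [ij|ij] := eqVneq i j.
  rewrite -ij in e *; rewrite -[i :: u]cat1s -[i :: v]cat1s.
  apply: braid_cat; [exact: braid_refl|apply: IH => //].
  by move: e; rewrite !pev_cons => /mulgI.
have [n' mij] := coxeter_finite_entry hm hW i j.
have [mC _ m2] := hm.
have n'2 := m2 _ _ _ (elimN eqP ij) mij.
have ji : j != i by rewrite eq_sym.
pose w := ev (i :: u); pose y := redw ((wX [set i; j])^-1 * w).
have wle_w : wle (wX [set i; j]) w.
  apply: wle_descents => k; rewrite !inE => /orP[]/eqP -> //.
  by rewrite /w e.
have main i' j' u' : i' != j' -> m i' j' = Some n' -> wX [set i'; j'] = wX [set i; j] ->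
    size u' < n -> size (i' :: u') = len (ev (i' :: u')) -> ev (i' :: u') = w ->
    i' :: u' ≡ alt i' j' n' ++ y.
  move=> ij' e' eX sz ru1 eu; have [_ ru1'] := reduced_cons ru1.
  have ea := ev_alt_wX ij' e'; have la := len_alt ij' e' (leqnn _).
  case: n' n'2 {mij} e' ea la => // n' _ e' ea la.
  have ey : ev (i' :: alt j' i' n' ++ y) = w.
    rewrite -[_ :: _]/(alt i' j' n'.+1 ++ y) pev_cat ea /y ev_redw eX.
    by rewrite mulKVg.
  have e1 : ev u' = ev (alt j' i' n' ++ y).
    by apply: (mulgI (s i')); rewrite -!pev_cons eu ey.
  rewrite /= -cat1s -[i' :: _ ++ _]cat1s.
  apply: braid_cat; [exact: braid_refl|apply: IH => //].
  rewrite -e1 -ru1' size_cat size_alt /y size_redw.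
  move: wle_w; rewrite /wle /radd mulKVg -eX -ea la => /eqP.
  by rewrite -eu -ru1 /=; move: (len _) => l; lia.
apply: braid_trans (main i j u ij mij erefl un ru erefl) _.
apply: braid_trans (braid_sym (main j i v ji _ _ _ rv (esym e))).
- by apply: braid_cat (braid_refl _ _); apply: braid_rel => //; apply/eqP.
- by rewrite mC.
- by rewrite finset.setUC.
- by move: rv; rewrite -e -ru => -[->].
Qed.

Lemma redw_mul x y : radd x y -> redw (x * y) ≡ redw x ++ redw y.
Proof.
move=> /eqP r; apply: matsumoto; rewrite ?pev_cat !ev_redw // ?size_redw //.
by rewrite size_cat !size_redw.
Qed.

Lemma redw_gen i : redw (s i) ≡ [:: i].
Proof. by apply: matsumoto; rewrite ?ev_redw ?pev1 ?size_redw ?len_gen. Qed.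

Lemma redw_prefix x w : wle x w -> redw w ≡ redw x ++ redw (x^-1 * w).
Proof. by move=> h; rewrite -[in redw w](mulKVg x w); apply: redw_mul. Qed.

(* Left multiplication by [u] on pairs (head, rest): the head of a positive
   word is its greatest prefix in [W]. *)
Definition act (u : W) (p : W * seq S) : W * seq S :=
  (u * cap u p.1, redw ((cap u p.1)^-1 * p.1) ++ p.2).

Definition peq (p q : W * seq S) := p.1 = q.1 /\ p.2 ≡ q.2.

Lemma peq_refl p : peq p p. Proof. by split; [|apply: braid_refl]. Qed.

Lemma peq_sym p q : peq p q -> peq q p.
Proof. by move=> [h1 h2]; split=> //; apply: braid_sym. Qed.

Lemma peq_trans q p r : peq p q -> peq q r -> peq p r.
Proof.
by move=> [h1 h2] [h3 h4]; split; [rewrite h1|apply: braid_trans h4].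
Qed.

Lemma act_peq u p q : peq p q -> peq (act u p) (act u q).
Proof. by move=> [h1 h2]; rewrite /act h1; split=> //=; rewrite h2. Qed.

Lemma act_mul u v p : radd u v -> peq (act (u * v) p) (act u (act v p)).
Proof.
case: p => h t uv; split; rewrite /= cap_mul //; first by rewrite mulgA.
have [h1 h2 h3] := capP v h; have [k1 k2 _] := capP (u * v) h.
have /andP[r1 _] : radd v (cap (u * v) h) && radd u (v * cap (u * v) h).
  by rewrite -radd_assoc uv k2.
have le := h3 _ k1 r1.
have -> : (v * cap (u * v) h)^-1 * (v * cap v h) = (cap (u * v) h)^-1 * cap v h.
  by rewrite invMg -mulgA mulKg.
rewrite catA -redw_mul; first by rewrite -mulgA mulKVg.
have := radd_assoc (cap (u * v) h) ((cap (u * v) h)^-1 * cap v h) ((cap v h)^-1 * h).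
by rewrite mulKVg (wleP le) (wleP h1) => /esym/andP[].
Qed.

Lemma act1 p : peq (act 1 p) p.
Proof.
have e : cap 1 p.1 = p.1.
  apply: cap_eq => //; first exact: wle_refl.
  by rewrite /radd len1 mul1g.
by split; rewrite /= e ?mul1g // mulVg redw1.
Qed.

Definition actw (u : seq S) (p : W * seq S) := foldr (fun i => act (s i)) p u.

Lemma actw_peq u p q : peq p q -> peq (actw u p) (actw u q).
Proof. by move=> pq; elim: u => //= i u; apply: act_peq. Qed.

Lemma actw_reduced u p : size u = len (ev u) -> peq (actw u p) (act (ev u) p).
Proof.
elim: u => [|i u IH] ru; first by rewrite pev_nil; apply/peq_sym/act1.
have [iu ru'] := reduced_cons ru.
apply: peq_trans (act_peq _ (IH ru')) _.
rewrite pev_cons; apply/peq_sym/act_mul.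
by rewrite radd_gen -invset_gen_mul -pev_cons.
Qed.

(** A braid relation equates two reduced words of one element of [W], and reduced words act through
    their value. *)
Lemma actw_braid u v p : u ≡ v -> peq (actw u p) (actw v p).
Proof.
move=> h; elim: h p => {u v}.
- move=> i j n /eqP ij e p.
  have [mC _ _] := hm.
  have ji : j != i by rewrite eq_sym.
  have e' : m j i = Some n by rewrite mC.
  apply: peq_trans (actw_reduced _ _) _.
    by rewrite size_alt (len_alt ij e).
  rewrite (gen_braid (elimN eqP ij) e); apply/peq_sym/actw_reduced.
  by rewrite size_alt (len_alt ji e').
- by move=> u p; apply: peq_refl.
- by move=> u v _ IH p; apply/peq_sym.
- by move=> u v w _ IH1 _ IH2 p; apply: peq_trans (IH1 p) (IH2 p).
- move=> u u' v v' _ IH1 _ IH2 p; rewrite /actw !foldr_cat.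
  exact: peq_trans (IH1 _) (actw_peq _ (IH2 p)).
Qed.

Lemma actw_eval u p : redw (actw u p).1 ++ (actw u p).2 ≡ u ++ redw p.1 ++ p.2.
Proof.
elim: u => [|i u IH]; first exact: braid_refl.
rewrite -cat1s -catA -IH /=; move: (actw u p) => [h t] /=.
have [h1 h2 _] := capP (s i) h.
by rewrite redw_mul // redw_gen (redw_prefix h1) -!catA.
Qed.

(** The first step of the greedy normal form; the tail is left unnormalised. *)
Definition headtail u := actw u (1, [::]).

Lemma headtail_eval u : redw (headtail u).1 ++ (headtail u).2 ≡ u.
Proof.
have := actw_eval u (1, [::]).
by rewrite /= redw1 !cats0.
Qed.

Lemma headtail_redw w u v : u ≡ redw w ++ v ->
  peq (headtail u) (act w (headtail v)).
Proof.
move=> h; apply: peq_trans (actw_braid _ h) _.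
rewrite /actw foldr_cat -[in act w](ev_redw w); apply: actw_reduced.
by rewrite ev_redw size_redw.
Qed.

Lemma prefix_head w u v : u ≡ redw w ++ v -> wle w (headtail u).1.
Proof.
move=> /headtail_redw[-> _]; rewrite /= wle_mul.
by have [_ h2 _] := capP w (headtail v).1.
Qed.

(** The generators in [X] are all descents of the head, so the question is settled by the weak
    order. *)
Lemma braid_lcm (X : {set S}) u : (forall i, i \in X -> exists v, u ≡ i :: v) ->
  exists v, u ≡ redw (wX X) ++ v.
Proof.
move=> h; have hX : wle (wX X) (headtail u).1.
  apply: wle_descents => i /h[v uv]; rewrite -wle_gen.
  by apply: (@prefix_head _ _ v); rewrite redw_gen.
exists (redw ((wX X)^-1 * (headtail u).1) ++ (headtail u).2).
by rewrite catA -redw_prefix // headtail_eval.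
Qed.

(** * Cancellation and the central element [Delta ^ 2] *)

Notation w0 := (wX [set: S]).

Lemma in_WXT w : w \in WX [set: S].
Proof. by rewrite -(ev_redw w); apply: ev_in_WX => i _; rewrite inE. Qed.

Lemma braid_cancel_w0 u v : redw w0 ++ u ≡ redw w0 ++ v -> u ≡ v.
Proof.
(* Nothing extends [w0], so acting by [w0] makes it the whole head and pushes the former head into
   the tail, where the word is recovered. *)
have cap0 h : cap w0 h = 1.
  apply: cap_eq; first exact: wle1.
    by rewrite /radd mulg1 len1 addn0.
  move=> z _ /eqP e; have /wle_len := wle_wX (in_WXT (w0 * z)).
  rewrite e => le; have : len z == 0 by move: le; move: (len _) (len _) => *; lia.
  by rewrite len_eq0 => /eqP ->; apply: wle1.
have main x y : x ≡ redw w0 ++ y -> (headtail x).2 ≡ y.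
  move=> /headtail_redw [_]; rewrite /= cap0 invg1 mul1g => ->.
  exact: headtail_eval.
by move=> h; apply: braid_trans (main _ _ h); apply/braid_sym/main/braid_refl.
Qed.

Lemma wX_snoc (X : {set S}) i : i \in X -> redw (wX X * s i) ++ [:: i] ≡ redw (wX X).
Proof.
move=> iX; rewrite -redw_gen -redw_mul; first by rewrite -mulgA gen_sq mulg1.
rewrite /radd -mulgA gen_sq mulg1 len_gen.
have -> : wX X * s i = (s i * wX X)^-1 by rewrite invMg genV wXV.
by rewrite lenV addn1; apply/eqP/len_gen_mulN/descent_wX.
Qed.

Lemma wX_cons (X : {set S}) i : i \in X -> i :: redw (s i * wX X) ≡ redw (wX X).
Proof.
move=> iX; rewrite -cat1s -redw_gen -redw_mul.
  by rewrite genK.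
by apply/radd_gen_descent/descent_wX.
Qed.

Lemma wX_comm (X : {set S}) i j : s j * wX X = wX X * s i -> s i * wX X = wX X * s j.
Proof.
by move=> e; rewrite -[s i](mulKg (wX X)) -e wXV -!mulgA wX_sq mulg1.
Qed.

Lemma wX_swap (X : {set S}) i : i \in X -> exists j, [/\ j \in X,
  s j * wX X = wX X * s i, j :: redw (wX X) ≡ redw (wX X) ++ [:: i]
  & i :: redw (wX X) ≡ redw (wX X) ++ [:: j] ].
Proof.
move=> iX; have [j jX e] := wX_conj iX; exists j.
have e' := wX_comm e.
split=> //.
  have e1 : (j :: redw (s j * wX X)) ++ [:: i] ≡ redw (wX X) ++ [:: i].
    by rewrite (wX_cons jX).
  by rewrite -e1 e cat_cons (wX_snoc iX).
have e1 : (i :: redw (s i * wX X)) ++ [:: j] ≡ redw (wX X) ++ [:: j].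
  by rewrite (wX_cons iX).
by rewrite -e1 e' cat_cons (wX_snoc jX).
Qed.

(** The letter [i] ends a reduced word of [w0]; completing it on the left reduces to cancelling
    [w0]. *)
Lemma braid_cancel_cons i u v : i :: u ≡ i :: v -> u ≡ v.
Proof.
move=> h; apply: braid_cancel_w0.
rewrite -(@wX_snoc [set: S] i) ?inE // -!catA.
by apply: braid_cat h.
Qed.

Definition ctr := redw w0 ++ redw w0.

Lemma ctr_swap u : u ++ ctr ≡ ctr ++ u.
Proof.
elim: u => [|i u IH]; first by rewrite cats0.
have [j [_ _ h1 h2]] := @wX_swap [set: S] i (finset.in_setT i).
rewrite cat_cons IH -cat1s -[i :: u in X in _ ≡ X]cat1s catA [X in _ ≡ X]catA.
apply: braid_cat => //.
by rewrite /ctr cat1s -cat_cons h2 -catA cat1s h1 catA.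
Qed.

Definition gen_compl i := redw (s i * w0) ++ redw w0.

Lemma gen_complL i : i :: gen_compl i ≡ ctr.
Proof. by rewrite /gen_compl -cat_cons wX_cons ?inE. Qed.

Lemma gen_complR i : gen_compl i ++ [:: i] ≡ ctr.
Proof.
have [j [_ e h1 h2]] := @wX_swap [set: S] i (finset.in_setT i).
rewrite /gen_compl -catA -h1 -cat1s catA /ctr.
rewrite (wX_comm e).
by rewrite wX_snoc ?inE.
Qed.

Lemma braid_cancel_ctr u v : ctr ++ u ≡ ctr ++ v -> u ≡ v.
Proof. by rewrite /ctr -!catA => /braid_cancel_w0/braid_cancel_w0. Qed.

(** * Positive elements and parabolic subgroups of the Artin group *)

Variables (A : groupType) (sigma : S -> A).
Hypothesis hA : is_presented_by (artin_rel m) sigma.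

Notation eA := (pev sigma).

Lemma braid_eA u v : u ≡ v -> eA u = eA v.
Proof.
apply: braid_pev => i j n ij e; case: hA => _ h.
rewrite -!eval_word_pos; apply/h/word_equiv_rel.
by exists i, j, n; rewrite !alternating_wordE.
Qed.

Let negs (u : word S) := count (fun l => l.2) u.
Let unsigned (u : word S) :=
  flatten [seq if l.2 then gen_compl l.1 else [:: l.1] | l <- u].
Let cpow n := flatten (nseq n ctr).

Let cpowD a b : cpow (a + b) = cpow a ++ cpow b.
Proof. by rewrite /cpow nseqD flatten_cat. Qed.

Let cpow_swap n u : u ++ cpow n ≡ cpow n ++ u.
Proof.
rewrite /cpow; elim: n => [|n IH]; first by rewrite /= cats0.
by rewrite /= catA ctr_swap -!catA IH.
Qed.

Let cpow_cancel n u v : cpow n ++ u ≡ cpow n ++ v -> u ≡ v.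
Proof.
rewrite /cpow; elim: n => //= n IH; rewrite -(catA ctr _ u) -(catA ctr _ v).
by move=> h; apply: IH; apply: braid_cancel_ctr.
Qed.

Let unsigned_pos u : unsigned (pos u) = u.
Proof. by rewrite /unsigned; elim: u => //= i u ->. Qed.

Let negs_pos u : negs (pos u) = 0%N.
Proof. by rewrite /negs; elim: u. Qed.

(* With [c = Delta ^ 2], a signed word [u] stands for the fraction
   [c ^ - negs u * unsigned u]; equality in [A] is equality of fractions. *)
Let word_equiv_fraction u v : word_equiv (artin_rel m) u v ->
  cpow (negs v) ++ unsigned u ≡ cpow (negs u) ++ unsigned v.
Proof.
elim=> {u v}.
- move=> u v [i [j [n [ij e -> ->]]]].
  by rewrite !alternating_wordE !negs_pos !unsigned_pos; apply: braid_rel.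
- move=> i [] /=; rewrite /cpow /unsigned /= ?cats0; last exact: gen_complL.
  exact: gen_complR.
- by [].
- by move=> u v _ h; apply: braid_sym.
- move=> u v w _ h1 _ h2; apply: (@cpow_cancel (negs v)).
  rewrite catA -cpowD addnC cpowD -catA h1 catA -cpowD addnC cpowD -catA h2.
  by rewrite !catA -!cpowD addnC.
- move=> u u' v v' _ h1 _ h2.
  rewrite /negs /unsigned !map_cat !flatten_cat !count_cat.
  rewrite -!/(negs _) -!/(unsigned _) addnC !cpowD -catA (catA (cpow (negs u'))) h1.
  rewrite -!catA catA -(cpow_swap _ (cpow _)) -catA (catA (cpow (negs v'))) -(cpow_swap (negs v')).
  rewrite -catA h2 (catA (unsigned u')) cpow_swap -!catA.
  by rewrite catA cpow_swap -catA.
Qed.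

(** Positive words carry no denominator, so equality of fractions is braid equivalence: the monoid
    embeds in [A]. *)
Lemma eA_inj u v : eA u = eA v -> u ≡ v.
Proof.
case: hA => _ h e; have: word_equiv (artin_rel m) (pos u) (pos v).
  by apply/h; rewrite !eval_word_pos.
by move=> /word_equiv_fraction; rewrite !negs_pos !unsigned_pos.
Qed.

Lemma eA_size u v : eA u = eA v -> size u = size v.
Proof. by move=> /eA_inj/braid_size. Qed.

Lemma positiveP g : positive sigma g <-> exists u, eA u = g.
Proof.
split.
  apply: (@smallest_sub _ _ _ [set g | exists u, eA u = g]%classic).
    split; first by exists [::]; rewrite pev_nil.
    by move=> x y [u <-] [v <-]; exists (u ++ v); rewrite pev_cat.
  by move=> _ [i _ <-]; exists [:: i]; rewrite pev1.
move=> [u <-] K [[K1 KM] KS]; elim: u => [|i u IH]; first by rewrite pev_nil.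
by rewrite pev_cons; apply: KM => //; apply: KS; exists i.
Qed.

Lemma positive_eA u : positive sigma (eA u).
Proof. by apply/positiveP; exists u. Qed.

Lemma positive_mul x y : positive sigma x -> positive sigma y -> positive sigma (x * y).
Proof.
by move=> /positiveP[u <-] /positiveP[v <-]; rewrite -pev_cat; apply: positive_eA.
Qed.

Lemma positiveV_eq1 x : positive sigma x -> positive sigma x^-1 -> x = 1.
Proof.
move=> /positiveP[u <-] /positiveP[v e].
have := @eA_size (v ++ u) [::]; rewrite pev_cat e mulVg pev_nil => /(_ erefl).
by rewrite size_cat; case: (u) => [|i u'] /=; [rewrite pev_nil|lia].
Qed.

(** * Standard parabolic subgroups of the Artin group and their Garside elements *)

Notation SP := (standard_parabolic sigma).

Lemma SP_ind (X : {set S}) (K : A -> Prop) : K 1 ->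
  (forall x y, K x -> K y -> K (x * y)) -> (forall x, K x -> K x^-1) ->
  (forall i, i \in X -> K (sigma i)) -> forall x, SP X x -> K x.
Proof.
move=> K1 KM KV Ks; apply: (@smallest_sub _ _ _ K) => //.
by move=> _ [i iX <-]; apply: Ks.
Qed.

Lemma SP1 (X : {set S}) : SP X 1. Proof. by move=> K [[[]]]. Qed.
Lemma SPM (X : {set S}) x y : SP X x -> SP X y -> SP X (x * y).
Proof.
move=> hx hy K hK; have [[[_ KM] _] _] := hK.
by apply: KM; [apply: hx|apply: hy].
Qed.
Lemma SPV (X : {set S}) x : SP X x -> SP X x^-1.
Proof. by move=> hx K hK; have [[_ KV] _] := hK; apply: KV; apply: hx. Qed.
Lemma SP_gen (X : {set S}) i : i \in X -> SP X (sigma i).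
Proof. by move=> iX K [_]; apply; exists i. Qed.
Lemma SP_eA (X : {set S}) u : {subset u <= X} -> SP X (eA u).
Proof.
elim: u => [|i u IH] h; first by rewrite pev_nil; apply: SP1.
rewrite pev_cons; apply: SPM; first by apply: SP_gen; rewrite h ?mem_head.
by apply: IH => j ju; rewrite h // inE ju orbT.
Qed.
(** The lift of the longest element; [is_garside_eq] identifies it with [Delta_X]. *)
Definition gar (X : {set S}) : A := eA (redw (wX X)).

(** Braid relations preserve the set of letters, so one reduced word over [X] is enough. *)
Lemma mem_redw_WX (X : {set S}) w : w \in WX X -> {subset redw w <= X}.
Proof.
move=> /WX_redw[u [uX eu su]] i.
rewrite (@braid_mem _ m _ u) //; first exact: uX.
by apply: matsumoto; rewrite ?ev_redw ?size_redw ?eu.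
Qed.

Lemma mem_redw_wX (X : {set S}) : {subset redw (wX X) <= X}.
Proof. exact: mem_redw_WX (wX_in X). Qed.

Lemma SP_gar (X : {set S}) : SP X (gar X).
Proof. exact: SP_eA (@mem_redw_wX X). Qed.

Lemma gar_swap (X : {set S}) i : i \in X -> exists j, [/\ j \in X,
  sigma j * gar X = gar X * sigma i & sigma i * gar X = gar X * sigma j].
Proof.
move=> /wX_swap[j [jX _ /braid_eA h1 /braid_eA h2]]; exists j; split=> //.
  by move: h1; rewrite pev_cons pev_cat pev1.
by move: h2; rewrite pev_cons pev_cat pev1.
Qed.

Lemma gar_gen_quo (X : {set S}) i : i \in X -> exists u,
  {subset u <= X} /\ eA (i :: u) = gar X.
Proof.
move=> iX; exists (redw (s i * wX X)); split.
  by apply: mem_redw_WX; rewrite groupM ?wX_in ?gen_in_WX.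
by apply/braid_eA/wX_cons.
Qed.

(** Conjugation by [gar X] acts on the generators as an involution: the same [j] serves both
    equations of [gar_swap]. *)
Lemma commute_gar2 (X : {set S}) x : SP X x -> commute (gar X ^+ 2) x.
Proof.
move: x; apply: SP_ind; first exact: commute1.
- by move=> x y; apply: commuteM.
- by move=> x; apply: commuteV.
move=> i /gar_swap[j [_ h1 h2]]; rewrite /commute expg2.
by rewrite -mulgA -h1 mulgA -h2 mulgA.
Qed.

Lemma SP_fraction (X : {set S}) x : SP X x ->
  exists n (u : seq S), {subset u <= X} /\ x * (gar X ^+ 2) ^+ n = eA u.
Proof.
set z := gar X ^+ 2.
have zc (u : seq S) n : {subset u <= X} -> commute (eA u) (z ^+ n).
  by move=> /SP_eA/commute_gar2/commute_sym; apply: commuteX.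
have KM a b : (exists n (u : seq S), {subset u <= X} /\ a * z ^+ n = eA u) ->
    (exists n (u : seq S), {subset u <= X} /\ b * z ^+ n = eA u) ->
    exists n (u : seq S), {subset u <= X} /\ a * b * z ^+ n = eA u.
  move=> [n [u [uX eu]]] [k [v [vX ev]]]; exists (k + n), (u ++ v); split.
    by move=> i; rewrite mem_cat => /orP[/uX|/vX].
  by rewrite pev_cat expgnDr mulgA -[a * b * _]mulgA ev -mulgA zc // mulgA eu.
move: x; apply: SP_ind => //.
- by exists 0, [::]; rewrite mul1g expg0 pev_nil.
- move=> x [n [u [uX eu]]].
  (* Inverses are cleared letter by letter: [gar X] starts with [sigma i], so a single factor
     [gar X ^ 2] makes the inverse of [sigma i] positive. *)
  have [k [v [vX ev]]] : exists n (v : seq S), {subset v <= X} /\ (eA u)^-1 * z ^+ n = eA v.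
    elim: u uX {eu} => [|i u IH] uX.
      by exists 0, [::]; rewrite pev_nil invg1 mul1g expg0.
    rewrite pev_cons invMg; apply: KM.
      by apply: IH => j ju; rewrite uX // inE ju orbT.
    have [v [vX ev]] := gar_gen_quo (uX i (mem_head _ _)).
    exists 1%N, (v ++ redw (wX X)); split.
      by move=> j; rewrite mem_cat => /orP[/vX|/mem_redw_wX].
    by rewrite expg1 /z expg2 pev_cat -{1}ev pev_cons -mulgA mulKg.
  exists k, (flatten (nseq n (redw (wX X) ++ redw (wX X))) ++ v); split.
    move=> j; rewrite mem_cat => /orP[|/vX //].
    move=> /flattenP[w]; rewrite mem_nseq => /andP[_ /eqP ->].
    by rewrite mem_cat orbb => /mem_redw_wX.
  have -> : x = eA u * z ^- n by rewrite -eu mulgK.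
  rewrite invMg invgK pev_cat -mulgA ev; congr (_ * _).
  elim: n {eu} => [|n IH]; first by rewrite pev_nil.
  by rewrite expgS /= pev_cat -IH pev_cat /z expg2.
- move=> i iX; exists 0, [:: i]; rewrite pev1 expg0 mulg1; split=> // j.
  by rewrite inE => /eqP ->.
Qed.

Lemma SP_setT x : SP [set: S] x.
Proof.
case: hA => /(_ x) [u <-] _; rewrite /eval_word.
elim: u => [|[i b] u IH]; first by rewrite big_nil; apply: SP1.
rewrite big_cons; apply: SPM => //=.
by case: b; first apply: SPV; apply: SP_gen; rewrite finset.in_setT.
Qed.

Lemma commute_center x : commute (gar [set: S] ^+ 2) x.
Proof. exact: commute_gar2 (SP_setT x). Qed.

Lemma eA_fraction x : exists n u, x * (gar [set: S] ^+ 2) ^+ n = eA u.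
Proof. by have [n [u [_ e]]] := SP_fraction (SP_setT x); exists n, u. Qed.

(** By reversal from [braid_lcm]: as [wX X] is an involution, its reduced words are stable under
    reversal. *)
Lemma suffix_lcm (X : {set S}) u :
  (forall i, i \in X -> exists v, eA u = eA v * sigma i) ->
  exists v, eA u = eA v * gar X.
Proof.
move=> h; have [i iX|v uv] := @braid_lcm X (rev u).
  have [v ev] := h i iX; exists (rev v).
  rewrite -rev_rcons; apply: braid_rev => //; apply: eA_inj.
  by rewrite ev pev_rcons.
exists (rev v); rewrite /gar -pev_cat; apply: braid_eA.
rewrite -[u]revK (braid_rev hm uv) rev_cat; apply: braid_cat => //.
apply: matsumoto; rewrite ?size_rev ?ev_rev ?ev_redw ?size_redw ?lenV //.
by rewrite wXV.
Qed.

Lemma prefix_lcm (X : {set S}) u :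
  (forall i, i \in X -> exists v, eA u = sigma i * eA v) ->
  exists v, eA u = gar X * eA v.
Proof.
move=> h; have [i iX|v uv] := @braid_lcm X u.
  have [v ev] := h i iX; exists v; apply: eA_inj.
  by rewrite ev pev_cons.
by exists v; rewrite /gar -pev_cat; apply: braid_eA.
Qed.

Lemma is_garside_eq (X : {set S}) D : is_garside sigma X D -> D = gar X.
Proof.
move=> [D1 D2 D3].
have h1 : prefix_le sigma D (gar X).
  apply: D3; first exact: positive_eA.
  move=> _ [i iX <-]; have [u [_ <-]] := gar_gen_quo iX.
  by rewrite /prefix_le pev_cons mulKg; apply: positive_eA.
have h2 : prefix_le sigma (gar X) D.
  have /positiveP[u eu] := D1; rewrite -eu /prefix_le.
  have [i iX|v ->] := @prefix_lcm X u; last by rewrite mulKg; apply: positive_eA.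
  have /positiveP[v ev] : prefix_le sigma (sigma i) D by apply: D2; exists i.
  by exists v; rewrite ev eu mulVKg.
have e : D^-1 * gar X = 1.
  by apply: positiveV_eq1 => //; rewrite invMg invgK.
by rewrite -[gar X](mulVKg D) e mulg1.
Qed.

(* The suffix order is invariant under right multiplication, so [u] is the
   suffix gcd of [a * u] and [b * u] for every [u] in the group. *)
Lemma pn_denominator x a b g : is_pn_normal_form sigma x a b ->
  positive sigma g -> positive sigma (x * g) -> prefix_le sigma b g.
Proof.
move=> [-> _ _ [_ _ gcd1]] hg hxg; rewrite /prefix_le.
have := gcd1 (g^-1 * b); rewrite /suffix_ge !invMg !invgK !mul1g !mulgA.
apply; first exact: hxg.
by rewrite mulgV mul1g.
Qed.

(** * Conjugation of parabolic subgroups by words without prefix in them *)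

Lemma prefix_reduced (X : {set S}) p v r w :
  {subset p <= X} -> {subset v <= X} -> (forall i, i \in X -> ~ exists y, w ≡ i :: y) ->
  v ++ r ≡ p ++ w -> exists q, p ≡ v ++ q.
Proof.
move=> + + hw; have [n] := ubnP (size p).
elim: n p v r => // n IH p [|i v] r pn pX vX h; first by exists p.
have iX : i \in X by apply: vX; rewrite mem_head.
have [p1 hp1] : exists p1, p ≡ i :: p1.
  case: p pn pX h => [|t p] /= pn pX h.
    by case: (hw i iX); exists (v ++ r); rewrite h.
  (* If the first letter [t] differs from [i], both are prefixes of the whole word, hence so is
     their alternating word. By induction its part after [t] is a prefix of [p], and the braid
     relation brings [i] to the front. *)
  have [<-|ti] := eqVneq t i; first by exists p.
  have it : i != t by rewrite eq_sym.
  have tX : t \in X by apply: pX; rewrite mem_head.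
  have [k mk] := coxeter_finite_entry hm hW t i.
  have mk' : m i t = Some k by have [mC _ _] := hm; rewrite mC.
  have [y hy] : exists y, t :: p ++ w ≡ redw (wX [set t; i]) ++ y.
    apply: braid_lcm => j; rewrite !inE => /orP[]/eqP ->.
      by exists (p ++ w).
    by exists (v ++ r); rewrite h.
  have hred : redw (wX [set t; i]) ≡ alt t i k.
    apply: matsumoto; rewrite ?ev_redw ?size_redw ?(ev_alt_wX ti mk) //.
    by rewrite size_alt -(ev_alt_wX ti mk) (len_alt ti mk).
  have k2 : 2 <= k by have [_ _ m2] := hm; apply: m2 mk; apply/eqP.
  case: k k2 mk mk' hred => // k k2 mk mk' hred.
  rewrite hred /= in hy; have hy' := braid_cancel_cons hy.
  have [q hq] : exists q, p ≡ alt i t k ++ q.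
    apply: (IH p (alt i t k) y) => //.
    - by move=> j jp; rewrite pX // inE jp orbT.
    - have altX : {subset alt i t k.+2 <= X}.
        by move=> j; rewrite mem_alt !inE => /orP[]/eqP ->.
      by move=> j jk; apply: altX; rewrite !alt_rcons mem_rcons inE mem_rcons inE jk !orbT.
    - exact: braid_sym.
  exists (alt t i k ++ q); rewrite hq -cat_cons -[t :: alt _ _ _]/(alt t i k.+1).
  by rewrite (braid_rel (elimN eqP ti) mk).
have p1X : {subset p1 <= X}.
  by move=> j jp; apply: pX; rewrite (braid_mem hm hp1) inE jp orbT.
have [q hq] : exists q, p1 ≡ v ++ q.
  apply: (IH p1 v r) => //.
  - by have := braid_size hp1; rewrite /= => e; rewrite -ltnS -e.
  - by move=> j jv; apply: vX; rewrite inE jv orbT.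
  - by apply: (@braid_cancel_cons i); rewrite -!cat_cons h hp1.
by exists q; rewrite hp1 hq.
Qed.

(** A central power clears denominators and makes [q ++ w ++ g] equivalent to [p ++ w], with [p] and
    [q] over [X]. By [prefix_reduced] the letters of [q] cancel against [p], and counting letters
    leaves one generator. *)
Lemma reduced_conj_gen (X : {set S}) w g :
  (forall i, i \in X -> ~ exists y, w ≡ i :: y) -> size g = 1%N ->
  SP X (eA w * eA g * (eA w)^-1) -> exists2 i, i \in X & eA w * eA g = sigma i * eA w.
Proof.
move=> hw sg SPx; have [n [p [pX]]] := SP_fraction SPx; set z := _ ^+ n.
have [q [qX eq_z]] : exists q, {subset q <= X} /\ eA q = z.
  exists (flatten (nseq n (redw (wX X) ++ redw (wX X)))); split.
    move=> j /flattenP[v]; rewrite mem_nseq => /andP[_ /eqP ->].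
    by rewrite mem_cat orbb => /mem_redw_wX.
  rewrite /z; elim: (n) => [|k IH]; first by rewrite pev_nil.
  by rewrite expgS /= pev_cat IH pev_cat expg2.
have zc : commute z (eA w * eA g * (eA w)^-1).
  exact: commute_sym (commuteX n (commute_sym (commute_gar2 SPx))).
rewrite -zc -eq_z => /(congr1 (fun x => x * eA w)).
rewrite /= -!mulgA mulVg mulg1 -!pev_cat => /eA_inj.
elim: q p qX pX {eq_z} => [|i q IH] p qX pX h.
  have sp : size p = 1%N.
    by have := braid_size h; rewrite /= !size_cat addnC sg => /addIn ->.
  case: p pX h sp => [|i [|]] // pX h _.
  exists i; first by apply: pX; rewrite mem_head.
  by rewrite -(pev_cons sigma i w); apply: braid_eA.
have [p1 hp1] : exists p1, p ≡ [:: i] ++ p1.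
  apply: (@prefix_reduced X p [:: i] (q ++ w ++ g) w) => // j.
  by rewrite inE => /eqP ->; apply: qX; rewrite mem_head.
apply: (IH p1).
- by move=> j jq; apply: qX; rewrite inE jq orbT.
- by move=> j jp; apply: pX; rewrite (braid_mem hm hp1) inE jp orbT.
- by apply: (@braid_cancel_cons i); rewrite -!cat_cons h hp1.
Qed.

Lemma conj_central_positive (X Y : {set S}) c h :
  (forall g, SP X g -> SP Y (h * g * h^-1)) ->
  (forall g, SP Y g -> SP X (h^-1 * g * h)) ->
  {subset c <= X} -> (forall g, SP X g -> commute (eA c) g) ->
  positive sigma (h * eA c * h^-1).
Proof.
(* A central factor makes [h] positive without changing conjugation by it. *)
move=> hXY hYX cX cC; have [n [w ew]] := eA_fraction h.
set z := _ ^+ n in ew.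
have zc g : commute z g.
  exact: commute_sym (commuteX n (commute_sym (commute_center g))).
have conj_w g : eA w * g * (eA w)^-1 = h * g * h^-1.
  by rewrite -ew invMg !mulgA -[h * z * g]mulgA zc mulgA mulgK.
have conj_w' g : (eA w)^-1 * g * eA w = h^-1 * g * h.
  transitivity (z^-1 * (h^-1 * g * h * z)); first by rewrite -ew invMg !mulgA.
  by rewrite -zc mulKg.
rewrite -conj_w.
have {}hXY g : SP X g -> SP Y (eA w * g * (eA w)^-1) by rewrite conj_w; apply: hXY.
have {}hYX g : SP Y g -> SP X ((eA w)^-1 * g * eA w) by rewrite conj_w'; apply: hYX.
move: hXY hYX {h n z ew zc conj_w conj_w'}.
have [n] := ubnP (size w); elim: n w => // n IH w wn hXY hYX.
have [[i [iY [w' ww']]]|red] := pselect (exists i, i \in Y /\ exists w', w ≡ i :: w').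
  have ew : eA w = sigma i * eA w' by rewrite (braid_eA ww') pev_cons.
  have w'n : size w' < n by have := braid_size ww'; rewrite /= => e; rewrite -ltnS -e.
  have hXY' g : SP X g -> SP Y (eA w' * g * (eA w')^-1).
    move=> /hXY h; have -> : eA w' * g * (eA w')^-1 =
      (sigma i)^-1 * (eA w * g * (eA w)^-1) * sigma i.
      by rewrite ew invMg !mulgA mulVg mul1g mulgVK.
    by apply: SPM; [apply: SPM => //; apply: SPV|]; apply: SP_gen.
  have hYX' g : SP Y g -> SP X ((eA w')^-1 * g * eA w').
    move=> h; have -> : (eA w')^-1 * g * eA w' =
      (eA w)^-1 * (sigma i * g * (sigma i)^-1) * eA w.
      by rewrite ew invMg !mulgA mulgVK mulgVK.
    by apply: hYX; apply: SPM; [apply: SPM => //|apply: SPV]; apply: SP_gen.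
  have /positiveP[v ev'] := IH w' w'n hXY' hYX'.
  (* Conjugation by [w'] brings [sigma i] into [A_X], where [eA c] is central; so restoring the
     prefix [i] does not change the conjugate. *)
  have cv : commute (sigma i) (eA v).
    have := cC _ (hYX' _ (SP_gen iY)); rewrite /commute ev' => e.
    have : eA w' * (eA c * ((eA w')^-1 * sigma i * eA w')) * (eA w')^-1 =
           eA w' * ((eA w')^-1 * sigma i * eA w' * eA c) * (eA w')^-1 by rewrite e.
    by rewrite !mulgA mulgV mul1g mulgK => ->.
  apply/positiveP; exists v.
  by rewrite ew invMg !mulgA -[sigma i * _ * _]mulgA -[sigma i * _ * _]mulgA -ev' cv mulgK.
have red' i : i \in Y -> ~ exists y, w ≡ i :: y.
  by move=> iY hy; apply: red; exists i.
(* Now [w] has no prefix in [Y], and each letter of [c] passes through [w] to become a letter of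
   [Y]. *)
elim: c cX {cC IH} => [|t c IHc] cX.
  by rewrite pev_nil mulg1 mulgV; apply/positiveP; exists [::]; rewrite pev_nil.
have tX : t \in X by apply: cX; rewrite mem_head.
have [i iY e] : exists2 i, i \in Y & eA w * eA [:: t] = sigma i * eA w.
  by apply: reduced_conj_gen => //; apply: hXY; rewrite pev1; apply: SP_gen.
rewrite pev1 in e; rewrite pev_cons mulgA e -!mulgA [eA w * _]mulgA.
apply: positive_mul; first by rewrite -(pev1 sigma i); apply: positive_eA.
by apply: IHc => j jc; apply: cX; rewrite inE jc orbT.
Qed.

(** * Garside elements under conjugation, and ribbons *)

Lemma gar_conj (X Y Y' : {set S}) :
  (forall t, t \in Y -> exists2 j, j \in Y' & sigma j * gar X = gar X * sigma t) ->
  (forall j, j \in Y' -> exists2 t, t \in Y & sigma j * gar X = gar X * sigma t) ->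
  gar Y' * gar X = gar X * gar Y.
Proof.
move=> hY hY'.
have conj_word u : {subset u <= Y} -> exists v, eA v * gar X = gar X * eA u.
  elim: u => [|t u IH] uY; first by exists [::]; rewrite !pev_nil mul1g mulg1.
  have [j _ ej] := hY _ (uY _ (mem_head _ _)).
  have [v ev'] : exists v, eA v * gar X = gar X * eA u.
    by apply: IH => i iu; apply: uY; rewrite inE iu orbT.
  by exists (j :: v); rewrite !pev_cons -mulgA ev' !mulgA ej.
have conj_word' u : {subset u <= Y'} -> exists v, eA u * gar X = gar X * eA v.
  elim: u => [|j u IH] uY; first by exists [::]; rewrite !pev_nil mul1g mulg1.
  have [t _ et] := hY' _ (uY _ (mem_head _ _)).
  have [v ev'] : exists v, eA u * gar X = gar X * eA v.
    by apply: IH => i iu; apply: uY; rewrite inE iu orbT.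
  by exists (t :: v); rewrite !pev_cons -mulgA ev' !mulgA et.
have [q1 e1] := conj_word _ (@mem_redw_wX Y).
have [q2 e2] := conj_word' _ (@mem_redw_wX Y').
rewrite -/(gar Y) -/(gar Y') in e1 e2.
(* The conjugate [q1] of [gar Y] starts with every letter of [Y'], hence with [gar Y'];
   symmetrically [q2] starts with [gar Y]. *)
have [j jY'|a ea] := @prefix_lcm Y' q1.
  have [t tY et] := hY' j jY'; have [u [uY eu]] := gar_gen_quo tY.
  have [v ev'] := conj_word _ uY; exists v.
  apply: (mulIg (gar X)); rewrite e1 -eu pev_cons mulgA -et -mulgA -ev'.
  by rewrite mulgA.
have [t tY|b eb] := @prefix_lcm Y q2.
  have [j jY et] := hY t tY; have [u [uY eu]] := gar_gen_quo jY.
  have [v ev'] := conj_word' _ uY; exists v.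
  apply: (mulgI (gar X)); rewrite -e2 -eu pev_cons -mulgA ev' mulgA et.
  by rewrite mulgA.
(* The two quotients [a] and [b] contribute no length, so they are empty. *)
have : eA (a ++ redw (wX X) ++ b) = eA (redw (wX X)).
  rewrite !pev_cat -/(gar X); apply: (mulgI (gar Y')).
  rewrite mulgA -ea mulgA e1 -mulgA -eb.
  by rewrite e2.
move=> /eA_size; rewrite !size_cat => sz.
have /size0nil a0 : size a = 0 by lia.
by rewrite -e1 ea a0 pev_nil mulg1.
Qed.

(** A reduced word of [wX Z * wX Y] must end with [i]: a last letter in [Y] would cancel against
    [wX Y] and make [wX Z] too short. *)
Lemma ribbon (Y : {set S}) i : i \notin Y -> exists r,
  eA (rcons r i) * gar Y = gar (i |: Y).
Proof.
move=> iY; set Z := i |: Y; pose w := wX Z * wX Y.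
have YZ : wX Y \in WX Z.
  by apply: (fintype.subsetP (genS _)) (wX_in Y); apply: imsetS; apply: finset.subsetUr.
have iZ : i \in Z by rewrite !inE eqxx.
have wZ : w \in WX Z by rewrite groupM ?wX_in.
have [_ /(_ _ YZ) leYZ] := wXP Z.
have lw : len w = len (wX Z) - len (wX Y).
  have -> : w = (wX Y * wX Z)^-1 by rewrite invMg !wXV.
  by rewrite lenV len_mul_wX.
have ewY : w * wX Y = wX Z by rewrite /w -mulgA wX_sq mulg1.
have r : radd w (wX Y) by rewrite /radd ewY lw subnK.
have [u [uZ eu su]] := WX_redw wZ.
have uw : u ≡ redw w by apply: matsumoto; rewrite ?ev_redw ?size_redw ?eu.
case/lastP: u uZ eu su uw => [|u t] uZ eu su uw.
  have := descent_wX iZ; rewrite -ewY -eu pev_nil mul1g.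
  by move=> /invset_wX[_]; rewrite gen_WX (negPf iY).
have ti : t = i.
  have: t \in Z by apply: uZ; rewrite mem_rcons mem_head.
  rewrite !inE => /orP[/eqP //|tY].
  have h := len_mul_le (ev u) (s t * wX Y).
  rewrite mulgA -pev_rcons eu ewY in h.
  have h2 := len_gen_mulN (descent_wX tY).
  have h3 := len_ev u.
  move: su h h2 h3 lw leYZ; rewrite size_rcons.
  move: (len (s t * _)) (len (wX Z)) (len w) (len (ev u)) (len (wX Y)) (size u).
  by move=> *; lia.
exists u; rewrite -ti (braid_eA uw) /gar -pev_cat; apply: braid_eA.
by rewrite -redw_mul // ewY.
Qed.

(** The product ends with [i] and with every letter of [Y], hence with [gar (i |: Y)]. Cancelling
    one [gar Y] leaves a word that ends with the ribbon, in particular with [i], so the exponent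
    descends to 0. *)
Lemma suffix_ribbon (Y : {set S}) i r u v k : i \notin Y ->
  eA (rcons r i) * gar Y = gar (i |: Y) ->
  eA u * gar Y ^+ k.+1 = eA v * sigma i ->
  exists p, eA u = eA p * eA (rcons r i).
Proof.
move=> iY er.
have step l y : eA u * gar Y ^+ l.+1 = eA y * sigma i ->
    exists q, eA u * gar Y ^+ l = eA q * eA (rcons r i).
  move=> e; have [x ex] : exists x, eA u * gar Y ^+ l.+1 = eA x.
    by exists (rcons y i); rewrite pev_rcons.
  have [j|q eq] := @suffix_lcm (i |: Y) x.
    rewrite !inE => /orP[/eqP ->|jY]; first by exists y; rewrite -ex.
    have /positiveP[t et] : positive sigma (gar Y ^+ l).
      elim: (l) => [|l' IH]; first by apply/positiveP; exists [::]; rewrite pev_nil.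
      by rewrite expgS; apply: positive_mul IH; apply: positive_eA.
    exists (u ++ t ++ redw (wX Y * s j)).
    have eg : gar Y = eA (redw (wX Y * s j)) * sigma j.
      by rewrite -pev_rcons -cats1 (braid_eA (wX_snoc jY)).
    by rewrite -ex expgSr !pev_cat et -!mulgA eg.
  exists q; apply: (mulIg (gar Y)).
  by rewrite -!mulgA er -expgSr ex eq.
elim: k v => [|k IH] v /step[q eq].
  by exists q; rewrite -eq expg0 mulg1.
by apply: (IH (q ++ r)); rewrite eq pev_rcons pev_cat mulgA.
Qed.

Lemma gen_conj_SP (Y : {set S}) i g : i \in Y ->
  SP Y ((sigma i)^-1 * g * sigma i) <-> SP Y g.
Proof.
move=> /SP_gen hi; split=> h; last by apply: SPM => //; apply: SPM => //; apply: SPV.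
have -> : g = sigma i * ((sigma i)^-1 * g * sigma i) * (sigma i)^-1.
  by rewrite !mulgA mulgV mul1g mulgK.
by apply: SPM; [apply: SPM|apply: SPV].
Qed.

(** * The minimal standardizer *)

Section MinimalStandardizer.
Variables (X : {set S}) (alpha a b : A) (e : nat).
Hypothesis e_gt0 : 0 < e.
Hypothesis gar_central : forall g, SP X g -> commute (gar X ^+ e) g.

Let x := alpha * gar X ^+ e * alpha^-1.
Let inP g := SP X (alpha^-1 * g * alpha).

(** The exponent [e] stays fixed while [Y] varies; by [gar_commute] this power remains central in
    [A_Y]. *)
Let standardizes (Y : {set S}) u :=
  eA u * gar Y ^+ e * (eA u)^-1 = x /\
  forall g, inP g <-> SP Y ((eA u)^-1 * g * eA u).

Let reducible (Y : {set S}) u :=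
  exists i u' v, eA u = eA u' * sigma i /\ eA u * gar Y ^+ e = eA v * sigma i.

Let exists_standardizes : exists u, standardizes X u.
Proof.
have [n [w ew]] := eA_fraction alpha; set z := _ ^+ n in ew; exists w.
have zc g : commute z g.
  exact: commute_sym (commuteX n (commute_sym (commute_center g))).
split; first by rewrite -ew /x invMg !mulgA -(mulgA alpha) zc mulgA mulgK.
move=> g; rewrite /inP.
suff -> : (eA w)^-1 * g * eA w = alpha^-1 * g * alpha by [].
transitivity (z^-1 * (alpha^-1 * g * alpha * z)); first by rewrite -ew invMg !mulgA.
by rewrite -zc mulKg.
Qed.

Let gar_commute Y u g : standardizes Y u -> SP Y g -> commute (gar Y ^+ e) g.
Proof.
move=> [hx hP] hg.
have: inP (eA u * g * (eA u)^-1).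
  by apply/hP; rewrite !mulgA mulVg mul1g mulgVK.
move=> /gar_central; rewrite /commute => h.
have hc : x * (eA u * g * (eA u)^-1) = eA u * g * (eA u)^-1 * x.
  have := congr1 (fun t => alpha * t * alpha^-1) h.
  by rewrite /x !mulgA !mulgK ?mulgVK mulgV mul1g ?mulgVK => ->.
move: hc; rewrite -hx !mulgA !mulgVK => /mulIg.
by rewrite -!mulgA => /mulgI.
Qed.

Let reduce_step Y u i u' v : standardizes Y u -> eA u = eA u' * sigma i ->
  eA u * gar Y ^+ e = eA v * sigma i ->
  exists Y' u'', size u'' < size u /\ standardizes Y' u''.
Proof.
move=> hS eu' euv; have [hx hP] := hS.
have [iY|iY] := boolP (i \in Y).
  exists Y, u'; split.
    by have := @eA_size u (rcons u' i); rewrite pev_rcons size_rcons => ->.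
  split.
    rewrite -hx eu' invMg !mulgA -[_ * sigma i * _]mulgA.
    by rewrite -(gar_commute hS (SP_gen iY)) !mulgA mulgK.
  move=> g; apply: iff_trans (hP g) _; rewrite eu' invMg.
  by have := @gen_conj_SP Y i ((eA u')^-1 * g * eA u') iY; rewrite !mulgA.
(* Otherwise [u] ends with the ribbon [gar Z * (gar Y)^-1]. As [gar Y] normalises [A_Y], dropping
   the ribbon replaces [Y] by its conjugate [Y'] under [gar Z]. *)
have [r er] := ribbon iY.
have [p ep] : exists p, eA u = eA p * eA (rcons r i).
  by move: euv; case: (e) e_gt0 => // k _; apply: suffix_ribbon.
set Z := i |: Y in er.
pose Y' := [set j | `[< exists2 t, t \in Y & sigma j * gar Z = gar Z * sigma t >]].
have YZ t : t \in Y -> t \in Z by rewrite !inE orbC => ->.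
have hY t : t \in Y -> exists2 j, j \in Y' & sigma j * gar Z = gar Z * sigma t.
  move=> tY; have [j [_ ej _]] := gar_swap (YZ _ tY).
  by exists j => //; rewrite inE; apply/asboolP; exists t.
have hY' j : j \in Y' -> exists2 t, t \in Y & sigma j * gar Z = gar Z * sigma t.
  by rewrite inE => /asboolP.
have eg := gar_conj hY hY'.
exists Y', p; split.
  have := eA_size (etrans ep (esym (pev_cat sigma p (rcons r i)))).
  by rewrite size_cat size_rcons => ->; lia.
have ep' : eA p = eA u * gar Y * (gar Z)^-1.
  by rewrite ep -er invMg !mulgA !mulgK.
split.
  have -> : gar Y' ^+ e = gar Z * gar Y ^+ e * (gar Z)^-1.
    elim: (e) => [|k IH]; first by rewrite !expg0 mulg1 mulgV.
    by rewrite expgS IH !mulgA eg expgS !mulgA.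
  rewrite ep' invMg invgK invMg !mulgA !mulgVK -hx.
  congr (_ * _); rewrite -(mulgA _ (gar Y)) -expgS expgSr !mulgA mulgK.
  by [].
move=> g; rewrite hP.
have eq1 : (eA u)^-1 * g * eA u =
    gar Y * ((gar Z)^-1 * ((eA p)^-1 * g * eA p) * gar Z) * (gar Y)^-1.
  by rewrite ep' !invMg !invgK !mulgA !mulgVK !mulgV !mul1g !mulgK.
have SPgar h : SP Y (gar Y * h * (gar Y)^-1) <-> SP Y h.
  split=> hh; last by apply: SPM; [apply: SPM => //|apply: SPV]; apply: SP_gar.
  have -> : h = (gar Y)^-1 * (gar Y * h * (gar Y)^-1) * gar Y.
    by rewrite !mulgA mulVg mul1g mulgVK.
  by apply: SPM; [apply: SPM => //; apply: SPV|]; apply: SP_gar.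
rewrite eq1 SPgar; move: (_^-1 * g * _) => h {eq1}; split.
  move=> hh; have -> : h = gar Z * ((gar Z)^-1 * h * gar Z) * (gar Z)^-1.
    by rewrite !mulgA mulgV mul1g mulgK.
  move: (_ * gar Z) hh => {}h; move: h; apply: SP_ind.
  - by rewrite mulg1 mulgV; apply: SP1.
  - move=> h1 h2 /SPM h /h; congr (SP Y' _); by rewrite !mulgA mulgVK.
  - by move=> h1 /SPV; rewrite !invMg invgK mulgA.
  - by move=> t /hY[j jY' <-]; rewrite mulgK; apply: SP_gen.
move: h; apply: SP_ind.
- by rewrite mulg1 mulVg; apply: SP1.
- move=> h1 h2 /SPM h /h; congr (SP Y _); by rewrite !mulgA mulgK.
- by move=> h1 /SPV; rewrite !invMg invgK mulgA.
- by move=> j /hY'[t tY]; rewrite -mulgA => ->; rewrite mulKg; apply: SP_gen.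
Qed.

Let exists_irreducible : exists Y u, standardizes Y u /\ ~ reducible Y u.
Proof.
have [u hu] := exists_standardizes; move: X hu => Y; have [n] := ubnP (size u).
elim: n u Y => // n IH u Y un hu.
have [[i [u' [v [eu euv]]]]|] := pselect (reducible Y u); last by exists Y, u.
have [Y' [u'' [lt hu'']]] := reduce_step hu eu euv.
exact: IH (leq_trans lt un) hu''.
Qed.

Hypothesis hab : is_pn_normal_form sigma x a b.

(** For irreducible [u], [b] is a prefix of [u] by [pn_denominator]. A last letter of the quotient
    would be a common suffix of [u] and [x * u], so [u] is [b]. *)
Lemma pn_standardizer :
  exists Y : {set S}, forall g, inP g <-> SP Y (b^-1 * g * b).
Proof.
have [Y [u [[hx hP] irr]]] := exists_irreducible; exists Y.
have posg k : positive sigma (gar Y ^+ k).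
  elim: k => [|k IH]; first by apply/positiveP; exists [::]; rewrite pev_nil.
  by rewrite expgS; apply: positive_mul IH; apply: positive_eA.
have xu : x * eA u = eA u * gar Y ^+ e by rewrite -hx mulgVK.
have := pn_denominator hab (positive_eA u).
rewrite xu => /(_ (positive_mul (positive_eA u) (posg e)))/positiveP[d].
have [xab /positiveP[aw eaw] /positiveP[bw ebw] _] := hab.
case/lastP: d => [|d i] ed.
  suff -> : b = eA u by [].
  by rewrite -[eA u](mulVKg b) -ed pev_nil mulg1.
have eu : eA u = b * eA d * sigma i by rewrite -mulgA -pev_rcons ed mulVKg.
case: irr; exists i, (bw ++ d), (aw ++ d); rewrite !pev_cat ebw eaw; split=> //.
by rewrite -xu xab eu !mulgA mulgVK.
Qed.

(** By [pn_denominator] it is enough that [x * g] is positive. It is [g] times the conjugate of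
    [gar X ^ e] by [g^-1 * alpha], which carries [A_X] to [A_Y]. *)
Lemma pn_minimal (Y : {set S}) g : positive sigma g ->
  (forall h, inP h <-> SP Y (g^-1 * h * g)) -> prefix_le sigma b g.
Proof.
move=> gpos hg; apply: (pn_denominator hab gpos).
have -> : x * g = g * ((g^-1 * alpha) * gar X ^+ e * (g^-1 * alpha)^-1).
  by rewrite /x invMg invgK !mulgA mulgV mul1g.
apply: positive_mul => //.
have [c [cX ec]] : exists c, {subset c <= X} /\ eA c = gar X ^+ e.
  exists (flatten (nseq e (redw (wX X)))); split.
    move=> j /flattenP[v]; rewrite mem_nseq => /andP[_ /eqP ->].
    exact: mem_redw_wX.
  elim: (e) => [|k IH]; first by rewrite pev_nil.
  by rewrite expgS /= pev_cat IH.
rewrite -ec; apply: (@conj_central_positive X Y) => //.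
- move=> h hh; have -> : g^-1 * alpha * h * (g^-1 * alpha)^-1 =
    g^-1 * (alpha * h * alpha^-1) * g by rewrite invMg invgK !mulgA.
  by apply/hg; rewrite /inP !mulgA mulVg mul1g mulgVK.
- move=> h hh; have -> : (g^-1 * alpha)^-1 * h * (g^-1 * alpha) =
    alpha^-1 * (g * h * g^-1) * alpha by rewrite invMg invgK !mulgA.
  by apply/hg; rewrite !mulgA mulVg mul1g mulgVK.
- by rewrite ec.
Qed.

End MinimalStandardizer.

End CoxeterGroup.

(** * From membership statements to parabolic subgroups as sets *)

Lemma conj_image (G : groupType) (H : set G) (g x : G) :
  ([set g * y * g^-1 | y in H]%classic x <-> H (g^-1 * x * g))%g.
Proof.
split=> [[y Hy <-]|h]; first by rewrite !mulgA mulVg mul1g mulgVK.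
by exists (g^-1 * x * g)%g; rewrite // !mulgA mulgV mul1g mulgK.
Qed.

Theorem theorem4 (S : finType) (m : S -> S -> option nat)
    (A : groupType) (sigma : S -> A)
    (hA : is_artin_tits_system m sigma) (hsph : is_spherical m)
    (X : {set S}) (alpha cX a b : A)
    (hc : is_central_garside sigma X cX)
    (hab : is_pn_normal_form sigma (alpha * cX * alpha^-1)%g a b) :
  is_minimal_standardizer sigma (parabolic sigma alpha X) b.
Proof.
have [hm hpres] := hA; have [W [s hW]] := hsph.
have [D [e [hD [e_gt0 [_ central]] _ ecX]]] := hc.
(* By uniqueness of the lcm, the given Garside element is the explicit [gar X]. *)
rewrite ecX (is_garside_eq hm hW hpres hD) in hab central.
have conj_parabolic g x :
    ([set g^-1 * p * g | p in parabolic sigma alpha X]%classic x <->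
     standard_parabolic sigma X (alpha^-1 * (g * x * g^-1) * alpha))%g.
  have := conj_image (parabolic sigma alpha X) g^-1%g x; rewrite invgK => h.
  by apply: iff_trans h _; apply: conj_image.
split.
  split; first by case: hab.
  have [Y hY] := pn_standardizer hm hW hpres e_gt0 central hab.
  exists Y; apply/seteqP; split=> x.
    by move=> /conj_parabolic/hY; rewrite !mulgA mulVg mul1g mulgVK.
  move=> hx; apply/conj_parabolic/hY.
  by rewrite !mulgA mulVg mul1g mulgVK.
move=> g [gpos [Y hY]]; apply: (pn_minimal hm hW hpres central hab gpos (Y := Y)).
move=> h; rewrite -hY.
have e1 : (g * (g^-1 * h * g) * g^-1 = h)%g by rewrite !mulgA mulgV mul1g mulgK.
by split=> [hh|/conj_parabolic]; [apply/conj_parabolic|]; rewrite e1.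
Qed.
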